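(* Let $T=\mathcal{N}\mathcal{C}$ on $\mathcal{H}_1\oplus\mathcal{H}_2$ and $T'=\mathcal{N}'\mathcal{C}'$ on $\mathcal{H}_1'\oplus\mathcal{H}_2'$ be two model operators as described in the context, with corresponding operators $N_1,N_2,C_1,C_2$ and $N_1',N_2',C_1',C_2'$, respectively. Suppose that $N_1$ and $N_1'$ are $K$-supported. Then the following are equivalent: (i) $T$ and $T'$ are unitarily equivalent. (ii) There are unitary operators $u_1$ of $\mathcal{H}_1$ onto $\mathcal{H}_1'$ and $u_2$ of $\mathcal{H}_2$ onto $\mathcal{H}_2'$ such that $$u_1N_1u_1^*=N_1',\quad u_2N_2u_2^*=N_2',\quad u_2=C_1'u_1C_2.$$
   Context: Hilbert spaces are complex; operators may be unbounded, with products on natural domains and equalities including domains. Antilinear means $A(\alpha x+\beta y)=\overline{\alpha}\,Ax+\overline{\beta}\,Ay$ for $\alpha,\beta\in\mathbb{C}$. A conjugation on a Hilbert space is an everywhere defined antilinear isometric operator $C$ with $C^2=I$. Model operator: $N_1,N_2$ are (possibly unbounded) normal linear operators on Hilbert spaces $\mathcal{H}_1,\mathcal{H}_2$; $\mathcal{N}=\begin{pmatrix}N_1&0\\0&N_2\end{pmatrix}$ on $\mathcal{H}_1\oplus\mathcal{H}_2$; $\mathcal{C}=\begin{pmatrix}0&C_2\\C_1&0\end{pmatrix}$ is a conjugation on $\mathcal{H}_1\oplus\mathcal{H}_2$, with $C_1:\mathcal{H}_1\to\mathcal{H}_2$ and $C_2:\mathcal{H}_2\to\mathcal{H}_1$,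 such that $\mathcal{N}\mathcal{C}=\mathcal{C}\mathcal{N}$; and $T:=\mathcal{N}\mathcal{C}=\begin{pmatrix}0&N_1C_2\\N_2C_1&0\end{pmatrix}$. The primed operator $T'$ is obtained in the same way from $N_1',N_2',C_1',C_2'$ on $\mathcal{H}_1'\oplus\mathcal{H}_2'$. $K:=\{z\in\mathbb{C}: z\neq 0,\ 0<\arg z\le\pi/2\}$. A normal linear operator $N$ with spectral measure $E_N$ is $K$-supported if $E_N(\mathbb{C}\setminus K)=0$. $T$ and $T'$ are unitarily equivalent if $UTU^*=T'$ for some linear unitary $U$ from the Hilbert space of $T$ onto that of $T'$. *)

(* Defs.v *)
(* MathComp-Analysis; the complex numbers are R[i] for R : realType. *)
From HB Require Import structures.
From mathcomp Require Import all_boot all_order all_algebra.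
From mathcomp Require Import all_classical all_reals all_analysis.
From mathcomp Require Import complex ring.

Set Implicit Arguments.
Unset Strict Implicit.
Unset Printing Implicit Defensive.

Import Order.TTheory GRing.Theory Num.Theory.
Import numFieldTopology.Exports numFieldNormedType.Exports.

Local Open Scope classical_set_scope.
Local Open Scope ring_scope.

(* The inner product is linear in its first argument and antilinear in the
   second one. *)
HB.mixin Record CompleteNormed_isHilbert (R : realType) H
    & CompleteNormedModule R[i] H := {
  hdot : {dot H for @Num.conj R[i]} ;
  hdotE : forall x : H, `|x| ^+ 2 = hdot x x
}.

#[short(type="hilbertType")]
HB.structure Definition Hilbert (R : realType) :=
  {H of CompleteNormedModule R[i] H & CompleteNormed_isHilbert R H}.

Arguments hdot {R s}.

(* The product of normed modules in the library carries the maximum norm, so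
   the orthogonal direct sum is a separate type. *)
Definition hsum (R : realType) (H1 H2 : hilbertType R) : Type := (H1 * H2)%type.

Section DirectSum.
Variables (R : realType) (H1 H2 : hilbertType R).
Local Notation H := (hsum H1 H2).

HB.instance Definition _ := GRing.Lmodule.copy H (H1 * H2)%type.

Definition hsum_norm (x : H) : R[i] := sqrtC (`|x.1| ^+ 2 + `|x.2| ^+ 2).

Lemma hsum_norm2_ge0 (x : H) : 0 <= `|x.1| ^+ 2 + `|x.2| ^+ 2.
Proof. by rewrite addr_ge0 // exprn_ge0. Qed.

Lemma hsum_normE (x : H) : hsum_norm x = `| `|x.1| + 'i * `|x.2| |.
Proof.
by rewrite -[RHS]sqrCK ?normr_ge0 // normC2_rect ?ger0_real ?normr_ge0.
Qed.

Lemma hsum_ler_normD (x y : H) : hsum_norm (x + y) <= hsum_norm x + hsum_norm y.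
Proof.
rewrite (hsum_normE x) (hsum_normE y); apply: le_trans (ler_normD _ _).
have -> : `|x.1| + 'i * `|x.2| + (`|y.1| + 'i * `|y.2|) =
    `|x.1| + `|y.1| + 'i * (`|x.2| + `|y.2|) by rewrite addrACA mulrDr.
rewrite -[leRHS]sqrCK ?normr_ge0 // normC2_rect ?ger0_real ?addr_ge0 //.
rewrite ler_sqrtC ?qualifE /= ?hsum_norm2_ge0 ?addr_ge0 ?exprn_ge0 ?addr_ge0 //.
by apply: lerD; rewrite lerXn2r ?nnegrE ?addr_ge0 ?normr_ge0 ?ler_normD.
Qed.

Lemma hsum_normrZ (l : R[i]) (x : H) : hsum_norm (l *: x) = `|l| * hsum_norm x.
Proof.
rewrite /hsum_norm /= !normrZ !exprMn -mulrDr.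
by rewrite sqrtCM ?qualifE /= ?exprn_ge0 ?hsum_norm2_ge0 // sqrCK.
Qed.

Lemma hsum_normr0_eq0 (x : H) : hsum_norm x = 0 -> x = 0.
Proof.
case: x => x y /eqP; rewrite sqrtC_eq0 paddr_eq0 ?exprn_ge0 //= !sqrf_eq0.
by rewrite !normr_eq0 => /andP[/eqP -> /eqP ->].
Qed.

HB.instance Definition _ := Lmodule_isNormed.Build R[i] H
  hsum_ler_normD hsum_normrZ hsum_normr0_eq0.

Lemma hsum_norm_fst (x : H) : `|x.1| <= `|x|.
Proof.
rewrite -[leLHS]sqrCK // ler_sqrtC ?qualifE /= ?hsum_norm2_ge0 ?exprn_ge0 //.
by rewrite lerDl exprn_ge0.
Qed.

Lemma hsum_norm_snd (x : H) : `|x.2| <= `|x|.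
Proof.
rewrite -[leLHS]sqrCK // ler_sqrtC ?qualifE /= ?hsum_norm2_ge0 ?exprn_ge0 //.
by rewrite lerDr exprn_ge0.
Qed.

Lemma hsum_norm_le (x : H) : `|x| <= `|x.1| + `|x.2|.
Proof.
rewrite [leLHS]hsum_normE; apply: le_trans (ler_normD _ _) _.
by rewrite normrM normCi mul1r !normr_id.
Qed.

Lemma hsum_cauchy_cvg (F : set_system H) : ProperFilter F -> cauchy F -> cvg F.
Proof.
move=> FF Fc.
have cau (H3 : hilbertType R) (p : H -> H3) :
    (forall x y, `|p x - p y| <= `|x - y|) -> cauchy (p @ F).
  move=> pl; apply/cauchyP => e e0.
  have /cauchyP/(_ _ e0)[x Fx] := Fc.
  exists (p x); rewrite /= /nbhs /=; apply: filterS Fx => y /=.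
  by rewrite -!ball_normE /=; apply: le_lt_trans.
have /cauchy_cvg/cvg_ex[/= a Fa] : cauchy ((fst : H -> H1) @ F).
  by apply: cau => x y; apply: (hsum_norm_fst (x - y)).
have /cauchy_cvg/cvg_ex[/= b Fb] : cauchy ((snd : H -> H2) @ F).
  by apply: cau => x y; apply: (hsum_norm_snd (x - y)).
apply/cvg_ex; exists ((a, b) : H); apply/cvgrPdist_lt => e e0.
have e20 : 0 < e / 2 by rewrite divr_gt0.
have /cvgrPdist_lt/(_ _ e20) Fa1 := Fa.
have /cvgrPdist_lt/(_ _ e20) Fb1 := Fb.
near=> x; apply: le_lt_trans (hsum_norm_le _) _.
rewrite [ltRHS]splitr; apply: ltrD; near: x; [exact: Fa1|exact: Fb1].
Unshelve. all: by end_near. Qed.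

HB.instance Definition _ := Uniform_isComplete.Build H hsum_cauchy_cvg.

Definition hsum_dot (x y : H) : R[i] := hdot x.1 y.1 + hdot x.2 y.2.

Lemma hsum_dot_zmodl y : zmod_morphism (hsum_dot^~ y).
Proof. by move=> u v; rewrite /hsum_dot /= !linearBl opprD addrACA. Qed.

Lemma hsum_dot_zmodr x : zmod_morphism (hsum_dot x).
Proof. by move=> u v; rewrite /hsum_dot /= !linearBr opprD addrACA. Qed.

Lemma hsum_dot_scall y : scalable_for *%R (hsum_dot^~ y).
Proof. by move=> a u; rewrite /hsum_dot /= !linearZl_LR mulrDr. Qed.

Lemma hsum_dot_scalr x : scalable_for (@Num.conj R[i] \; *%R) (hsum_dot x).
Proof. by move=> a u; rewrite /hsum_dot /= !linearZr_LR /= mulrDr. Qed.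

HB.instance Definition _ := isBilinear.Build R[i] H H R[i] *%R
  (@Num.conj R[i] \; *%R) hsum_dot
  hsum_dot_zmodl hsum_dot_zmodr hsum_dot_scall hsum_dot_scalr.

Lemma hsum_dot_herm (x y : H) :
  hsum_dot x y = (-1) ^+ false * (hsum_dot y x)^*.
Proof.
by rewrite mul1r rmorphD /hsum_dot (hermC _ x.1) (hermC _ x.2) !expr0 !mul1r.
Qed.

HB.instance Definition _ := isHermitianSesquilinear.Build R[i] H false
  (@Num.conj R[i]) hsum_dot hsum_dot_herm.

Lemma hsum_dotE (x : H) : `|x| ^+ 2 = hsum_dot x x.
Proof. by rewrite [LHS]sqrtCK !hdotE. Qed.

Lemma hsum_dot_gt0 (x : H) : x != 0 -> 0 < hsum_dot x x.
Proof. by move=> x0; rewrite -hsum_dotE exprn_gt0 ?normr_gt0. Qed.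

HB.instance Definition _ := isDotProduct.Build R[i] H hsum_dot hsum_dot_gt0.

HB.instance Definition _ := CompleteNormed_isHilbert.Build R H hsum_dotE.

End DirectSum.

(* A possibly unbounded operator: only the values of [app] on [dom] matter, so
   equality of operators is [op_eq] and not Leibniz equality. *)
Record operator (U V : Type) := Operator { dom : set U ; app : U -> V }.

Arguments Operator {U V}.

Definition op_eq (U V : Type) (A B : operator U V) : Prop :=
  dom A = dom B /\ {in dom A, app A =1 app B}.

Definition op_comp (U V W : Type) (A : operator V W) (B : operator U V) :
    operator U W :=
  Operator [set x | dom B x /\ dom A (app B x)] (app A \o app B).

Definition op_total (U V : Type) (f : U -> V) : operator U V :=
  Operator setT f.

Declare Scope operator_scope.
Delimit Scope operator_scope with op.
Notation "A =op B" := (op_eq A B) (at level 70, no associativity) : type_scope.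
Notation "A * B" := (op_comp A B) : operator_scope.
Bind Scope operator_scope with operator.
Arguments op_eq {U V} (A B)%_op.

Section Operators.
Variable R : realType.
Implicit Types H : hilbertType R.

Definition linear_operator H1 H2 (A : operator H1 H2) : Prop :=
  [/\ dom A 0,
      forall (a : R[i]) x y, dom A x -> dom A y -> dom A (a *: x + y) &
      forall (a : R[i]) x y, dom A x -> dom A y ->
        app A (a *: x + y) = a *: app A x + app A y].

(* When the domain of [A] is dense there is at most one [z] as below. *)
Definition adjoint H1 H2 (A : operator H1 H2) : operator H2 H1 :=
  let is_value (y : H2) (z : H1) :=
    forall x, dom A x -> hdot (app A x) y = hdot x z in
  Operator [set y | exists z, is_value y z]
           (fun y => xget 0 [set z | is_value y z]).

Definition closed_operator H1 H2 (A : operator H1 H2) : Prop :=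
  closed [set p : H1 * H2 | dom A p.1 /\ p.2 = app A p.1].

Definition normal_operator H (N : operator H H) : Prop :=
  [/\ linear_operator N, dense (dom N), closed_operator N &
      (adjoint N * N =op N * adjoint N)%op].

Definition unitary H1 H2 (U : H1 -> H2) : Prop :=
  [/\ linear U, forall x y, hdot (U x) (U y) = hdot x y & range U = setT].

Definition conjugation H (C : H -> H) : Prop :=
  [/\ forall (a b : R[i]) x y,
        C (a *: x + b *: y) = a^* *: C x + b^* *: C y,
      forall x, `|C x| = `|x| &
      involutive C].

Definition unitary_conj H1 H2 (U : H1 -> H2) (A : operator H1 H1) :
    operator H2 H2 :=
  (op_total U * (A * adjoint (op_total U)))%op.

Definition unitarily_equivalent H1 H2
    (A : operator H1 H1) (B : operator H2 H2) : Prop :=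
  exists2 U : H1 -> H2, unitary U & (unitary_conj U A =op B).

End Operators.

Lemma hdot_CauchySchwarz (R : realType) (H : hilbertType R) (x y : H) :
  `|hdot x y| <= `|x| * `|y|.
Proof.
have [->|y0] := eqVneq y 0; first by rewrite linear0r !normr0 mulr0.
have yy0 : hdot y y != 0 by rewrite gt_eqF // neq0_dnorm_gt0.
have yyJ : (hdot y y)^* = hdot y y by rewrite geC0_conj // dnorm_ge0.
set a := hdot x y / hdot y y.
have : 0 <= hdot (x - a *: y) (x - a *: y) by exact: dnorm_ge0.
have -> : hdot (x - a *: y) (x - a *: y) =
    hdot x x - `|hdot x y| ^+ 2 / hdot y y.
  have Zl u v : hdot (a *: u) v = a * hdot u v by exact: linearZl_LR.
  have Zr u v : hdot u (a *: v) = a^* * hdot u v by exact: linearZr_LR.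
  have yx : hdot y x = (hdot x y)^* by rewrite hermC expr0 mul1r.
  rewrite linearBl !linearBr /= Zl !Zr Zl yx normCK /a rmorphM fmorphV /= yyJ.
  move: yy0; generalize (hdot y y) (hdot x y)^* (hdot x x) (hdot x y).
  by move=> p q r s p0; field.
rewrite subr_ge0 ler_pdivrMr ?neq0_dnorm_gt0 // -!hdotE -exprMn.
by rewrite ler_pXn2r // nnegrE ?mulr_ge0 ?normr_ge0.
Qed.

Definition borelC (R : realType) := g_sigma_algebraType (@open R[i]^o).

Record spectral_measure (R : realType) (H : hilbertType R) := SpectralMeasure {
  pvm :> set (borelC R) -> H -> H ;
  pvm_linear : forall A, measurable A -> linear (pvm A) ;
  pvm_selfadjoint : forall A, measurable A ->
    forall x y, hdot (pvm A x) y = hdot x (pvm A y) ;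
  pvm_idempotent : forall A, measurable A ->
    forall x, pvm A (pvm A x) = pvm A x ;
  pvm0 : pvm set0 = (fun=> 0) ;
  pvmT : pvm setT = id ;
  pvm_sigma_additive : forall F : (set (borelC R))^nat,
    (forall n, measurable (F n)) -> trivIset setT F ->
    forall x, (fun n => \sum_(i < n) pvm (F i) x) @ \oo -->
              pvm (\bigcup_n F n) x
}.

Section SpectralMeasure.
Variables (R : realType) (H : hilbertType R).
Implicit Types (E : spectral_measure H) (x : H).

(* A measure of the library is nonnegative on all sets, including those that
   are not measurable, where E is unconstrained. *)
Definition scalar_measure E x (A : set (borelC R)) : \bar R :=
  if `[< measurable A >] then (complex.Re (hdot (E A x) x))%:E else 0%E.

Lemma scalar_measure0 E x : scalar_measure E x set0 = 0%E.
Proof. by rewrite /scalar_measure pvm0 linear0l; case: ifP. Qed.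

Lemma scalar_measure_ge0 E x A : (0 <= scalar_measure E x A)%E.
Proof.
rewrite /scalar_measure; case: asboolP => // mA; rewrite lee_fin.
rewrite -(pvm_idempotent E mA) (pvm_selfadjoint E mA) -hdotE.
by have := exprn_ge0 2 (normr_ge0 (E A x)); rewrite lecE => /andP[].
Qed.

Lemma scalar_measure_sigma_additive E x :
  semi_sigma_additive (scalar_measure E x).
Proof.
move=> F mF tF mU; rewrite [X in _ --> X]/scalar_measure asboolT //.
have -> : (fun n => \sum_(0 <= i < n) scalar_measure E x (F i))%E =
    EFin \o (fun n => complex.Re (hdot (\sum_(i < n) E (F i) x) x)).
  apply/funext => n /=; rewrite big_mkord linear_sumlz.
  elim/big_ind2: _ => /= [//|[? ?] _ [? ?] _ -> -> //|i _].
  by rewrite /scalar_measure asboolT.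
apply: cvg_EFin; first by near=> n.
apply/cvgrPdist_lt => e e0.
have ex : 0 < e%:C%C / (`|x| + 1) :> R[i].
  by rewrite divr_gt0 ?ltcR // ltr_wpDl ?normr_ge0.
have /cvgrPdist_lt/(_ _ ex) Fe := @pvm_sigma_additive _ _ E F mF tF x.
near=> n; rewrite -ltcR.
have /le_lt_trans : (`|complex.Re (hdot (E (\bigcup_n F n) x) x) -
    complex.Re (hdot (\sum_(i < n) E (F i) x) x)|)%:C%C <=
    `|E (\bigcup_n F n) x - \sum_(i < n) E (F i) x| * `|x|.
  apply: le_trans (hdot_CauchySchwarz _ _); rewrite linearBl /=.
  by apply: le_trans (normc_ge_Re _); case: (hdot _ _) => ? ?;
     case: (hdot _ _) => ? ?.
apply; apply: (@le_lt_trans _ _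
    (`|E (\bigcup_n F n) x - \sum_(i < n) E (F i) x| * (`|x| + 1))).
  by rewrite ler_wpM2l ?lerDl.
rewrite -ltr_pdivlMr ?ltr_wpDl ?normr_ge0 //.
near: n; exact: Fe.
Unshelve. all: by end_near. Qed.

HB.instance Definition _ E x := isMeasure.Build _ (borelC R) R
  (scalar_measure E x) (scalar_measure0 E x) (scalar_measure_ge0 E x)
  (@scalar_measure_sigma_additive E x).

(* N is the integral of z with respect to E: its domain consists of the x such
   that |z|^2 is integrable for <E(.)x, x>, and the quadratic form of N (which
   determines N, by polarization) is the integral of z. *)
Definition spectral_measure_of (N : operator H H) E : Prop :=
  dom N = [set x | (\int[scalar_measure E x]_z
             (complex.Re z ^+ 2 + complex.Im z ^+ 2)%:E < +oo)%E] /\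
  forall x, dom N x ->
    hdot (app N x) x = Complex (\int[scalar_measure E x]_z complex.Re z)
                               (\int[scalar_measure E x]_z complex.Im z).

Definition is_arg (z : R[i]) (t : R) : Prop :=
  - pi < t <= pi /\ z = `|z| * Complex (cos t) (sin t).

Definition K : set R[i] :=
  [set z | z != 0 /\ exists2 t, is_arg z t & 0 < t <= pi / 2].

(* By the spectral theorem, a normal operator N has exactly one E such that
   [spectral_measure_of N E]. *)
Definition K_supported (N : operator H H) : Prop :=
  exists2 E, spectral_measure_of N E & E (~` K) = (fun=> 0).

End SpectralMeasure.

Section ModelOperator.
Variables (R : realType) (H1 H2 : hilbertType R).
Variables (N1 : operator H1 H1) (N2 : operator H2 H2).
Variables (C1 : H1 -> H2) (C2 : H2 -> H1).

Definition model_N : operator (hsum H1 H2) (hsum H1 H2) :=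
  Operator [set x | dom N1 x.1 /\ dom N2 x.2]
           (fun x => (app N1 x.1, app N2 x.2)).

Definition model_C : hsum H1 H2 -> hsum H1 H2 := fun x => (C2 x.2, C1 x.1).

Definition model_data : Prop :=
  [/\ normal_operator N1, normal_operator N2, conjugation model_C &
      (model_N * op_total model_C =op op_total model_C * model_N)%op].

Definition model_T : operator (hsum H1 H2) (hsum H1 H2) :=
  (model_N * op_total model_C)%op.

End ModelOperator.

(* Main.v *)
(* (ii) only asks for a unitary u1 with u1 N1 u1* = N1': then u2 := C1' u1 C2
   does the rest. Let U intertwine T and T'. Since T^2 = N1^2 (+) N2^2 and
   N2 = C1 N1 C2, the spectral subspace of T^2 for a closed disc of center c is
   characterized by the growth of (T^2 - c)^n x, which U preserves; closed discs
   generate the Borel sets, so U intertwines all the spectral projections of T^2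
   and T'^2. Squaring is injective on K, hence the entry G : H1 -> H1' of U
   intertwines the spectral measures of N1 and N1', and so does the partial
   isometry in its polar decomposition.
   There remain the kernels k of G and k' of its adjoint. U maps k into H2'. The
   spectrum of N1^2 lies in the upper half-plane and that of N2'^2 in the lower
   one, so only the negative real axis counts on k, and x |-> C2' U x is an
   antiunitary map of k onto k' that intertwines the spectral measures. Composed
   with a conjugation of k that commutes with the spectral measure of N1, it
   completes the partial isometry to a unitary. *)
Require Import Defs.
From mathcomp Require Import all_boot all_order all_algebra.
From mathcomp Require Import all_classical all_reals all_analysis.
From mathcomp Require Import measurable_realfun complex ring lra.

Set Implicit Arguments.
Unset Strict Implicit.
Unset Printing Implicit Defensive.

Import Order.TTheory GRing.Theory Num.Theory.
Import numFieldTopology.Exports numFieldNormedType.Exports.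

Local Open Scope classical_set_scope.
Local Open Scope ring_scope.

(** * Hilbert spaces *)

(** A spectral measure meets its operator only through the domain and the quadratic form, so two
    devices recur. Commutation with N comes by transport: a unitary that respects the spectral
    measures preserves every scalar measure, hence the domain and the form, hence by polarization
    the operator. Unitaries come as maximal sets of compatible pairs, so that a polar decomposition,
    a reflection in a subspace or the gluing of two isometries becomes a choice of pairs. The
    obstacle is that T^2 does not tell H1 and H2 apart: a spectral point ti of N1, t > 0, and the
    conjugate point -ti of N2 have the same square, and U may mix the summands there, so G need not
    be unitary. On the kernels T itself has to be used: it places the antiunitary image of k in k'
    up to a factor N1', which can be cancelled because 0 is not in K. *)

Section HilbertBasics.
Variables (R : realType) (H : hilbertType R).
Implicit Types (x y z : H) (a : R[i]) (e : R).

Lemma hdotDl x y z : hdot (x + y) z = hdot x z + hdot y z.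
Proof. exact: linearDl. Qed.

Lemma hdotDr x y z : hdot x (y + z) = hdot x y + hdot x z.
Proof. exact: linearDr. Qed.

Lemma hdotBl x y z : hdot (x - y) z = hdot x z - hdot y z.
Proof. exact: linearBl. Qed.

Lemma hdotBr x y z : hdot x (y - z) = hdot x y - hdot x z.
Proof. exact: linearBr. Qed.

Lemma hdotZl a x y : hdot (a *: x) y = a * hdot x y.
Proof. exact: linearZl_LR. Qed.

Lemma hdotZr a x y : hdot x (a *: y) = a^* * hdot x y.
Proof. exact: linearZr_LR. Qed.

Lemma hdotC x y : hdot x y = (hdot y x)^*.
Proof. by rewrite hermC expr0 mul1r. Qed.

Lemma hdot0l x : hdot 0 x = 0.
Proof. exact: linear0l. Qed.

Lemma hdot0r x : hdot x 0 = 0.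
Proof. exact: linear0r. Qed.

Lemma hdotNl x y : hdot (- x) y = - hdot x y.
Proof. exact: linearNl. Qed.

Lemma hdotNr x y : hdot x (- y) = - hdot x y.
Proof. exact: linearNr. Qed.

Lemma hdot_eq0C x y : hdot x y = 0 -> hdot y x = 0.
Proof. by move=> xy; rewrite hdotC xy conjC0. Qed.

(* The library norm takes its values in R[i]; hn is the same number in R, where
   lra and nra apply. *)
Definition hn x : R := complex.Re `|x|.

Lemma hnE x : `|x| = (hn x)%:C%C.
Proof. by rewrite /hn RRe_real ?normr_real. Qed.

Lemma hn_ge0 x : 0 <= hn x.
Proof. by rewrite -lecR -hnE normr_ge0. Qed.

Lemma hn0 : hn (0 : H) = 0.
Proof. by apply: complexI; rewrite -hnE normr0. Qed.

Lemma hnN x : hn (- x) = hn x.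
Proof. by apply: complexI; rewrite -!hnE normrN. Qed.

Lemma hnB x y : hn (x - y) = hn (y - x).
Proof. by rewrite -hnN opprB. Qed.

Lemma hnD x y : hn (x + y) <= hn x + hn y.
Proof. by rewrite -lecR rmorphD /= -!hnE ler_normD. Qed.

Lemma hn_triangle y x z : hn (x - z) <= hn (x - y) + hn (y - z).
Proof. by apply: le_trans (hnD _ _); rewrite addrA subrK. Qed.

Lemma hnZ a x : hn (a *: x) = complex.Re `|a| * hn x.
Proof.
apply: complexI; rewrite -hnE normrZ rmorphM /= -hnE; congr (_ * _).
Qed.

Lemma hnZr (t : R) x : hn (t%:C%C *: x) = `|t| * hn x.
Proof. by rewrite hnZ normc_def /= expr0n /= addr0 sqrtr_sqr. Qed.

Lemma hn_eq0 x : hn x = 0 -> x = 0.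
Proof. by move=> x0; apply/normr0_eq0; rewrite hnE x0. Qed.

Lemma hn2E x : hdot x x = (hn x ^+ 2)%:C%C.
Proof. by rewrite -hdotE hnE rmorphXn. Qed.

Lemma hdotxx_eq0 x : hdot x x = 0 -> x = 0.
Proof.
rewrite hn2E => /complexI/eqP; rewrite sqrf_eq0 => /eqP; exact: hn_eq0.
Qed.

Lemma hn_sq x : hn x ^+ 2 = complex.Re (hdot x x).
Proof. by rewrite hn2E. Qed.

Lemma hn_sqD x y :
  hn (x + y) ^+ 2 = hn x ^+ 2 + hn y ^+ 2 + 2 * complex.Re (hdot x y).
Proof.
rewrite !hn_sq hdotDl !hdotDr (hdotC y x).
by case: (hdot x x) (hdot y y) (hdot x y) => [a ?] [b ?] [c ?] /=; ring.
Qed.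

Lemma pythagoras x y : hdot x y = 0 -> hn (x + y) ^+ 2 = hn x ^+ 2 + hn y ^+ 2.
Proof. by move=> xy; rewrite hn_sqD xy mulr0 addr0. Qed.

Lemma parallelogram x y :
  hn (x + y) ^+ 2 + hn (x - y) ^+ 2 = 2 * hn x ^+ 2 + 2 * hn y ^+ 2.
Proof.
by rewrite !hn_sqD hnN hdotNr; case: (hdot x y) => c ? /=; ring.
Qed.

Lemma hn_le_sq x (y : R) : 0 <= y -> hn x ^+ 2 <= y ^+ 2 -> hn x <= y.
Proof. by move=> y0; rewrite ler_pXn2r // nnegrE ?hn_ge0. Qed.

Lemma hdot_le x y : `|hdot x y| <= (hn x * hn y)%:C%C.
Proof. by rewrite rmorphM /= -!hnE hdot_CauchySchwarz. Qed.

Lemma Re_hdot_le x y : `|complex.Re (hdot x y)| <= hn x * hn y.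
Proof. by rewrite -lecR; apply: le_trans (hdot_le x y); exact: normc_ge_Re. Qed.

Lemma hdot_ext x y : (forall z, hdot x z = hdot y z) -> x = y.
Proof.
move=> xy; apply/eqP; rewrite -subr_eq0; apply/eqP/hdotxx_eq0.
by rewrite hdotBl xy subrr.
Qed.

(** Sequences with real tolerances, instead of filters with tolerances in R[i], keep the estimates
    within reach of [lra]. *)
Definition sconv (u : nat -> H) x :=
  forall e, 0 < e -> exists N, forall n, (N <= n)%N -> hn (u n - x) < e.

Definition scauchy (u : nat -> H) := forall e, 0 < e ->
  exists N, forall m n, (N <= m)%N -> (N <= n)%N -> hn (u m - u n) < e.

Lemma sconv_cvg u x : u @ \oo --> x -> sconv u x.
Proof.
move=> /cvgrPdist_lt ux e e0; have := ux e%:C%C; rewrite ltcR => /(_ e0).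
case=> N _ uN; exists N => n Nn; rewrite hnB -ltcR -hnE; exact: uN.
Qed.

Lemma complex_lt_RRe (e : R[i]) : 0 < e -> 0 < complex.Re e /\ e = (complex.Re e)%:C%C.
Proof. by case: e => a b; rewrite ltcE /= => /andP[/eqP -> ->]. Qed.

Lemma scauchy_sconv u : scauchy u -> exists x, sconv u x.
Proof.
move=> uc; have : cauchy (u @ \oo).
  apply/cauchyP => e /complex_lt_RRe[e0 ->].
  have [N uN] := uc _ e0; exists (u N); exists N => // n /= Nn.
  by rewrite -ball_normE /= hnE ltcR; apply: uN.
by move=> /cauchy_cvg/cvg_ex[/= x ux]; exists x; exact: sconv_cvg.
Qed.

Lemma sconv_scauchy u x : sconv u x -> scauchy u.
Proof.
move=> ux e e0; have [|N uN] := ux (e / 2); first by rewrite divr_gt0.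
exists N => m n Nm Nn; apply: le_lt_trans (hn_triangle x _ _) _.
by rewrite [ltRHS]splitr (hnB x); apply: ltrD; apply: uN.
Qed.

Lemma small_eq0 (r C : R) : 0 <= r -> (forall e, 0 < e -> r <= C * e) -> r = 0.
Proof.
move=> r0 rC; apply/eqP; rewrite eq_le r0 andbT leNgt; apply/negP => rp.
have C0 : 0 < `|C| + 1 by rewrite ltr_wpDl.
have := rC (r / (2 * (`|C| + 1))); rewrite divr_gt0 ?mulr_gt0 // => /(_ isT).
apply/negP; rewrite -ltNge mulrA ltr_pdivrMr ?mulr_gt0 //.
have : C * r <= `|C| * r by rewrite ler_wpM2r // ler_norm.
nra.
Qed.

Lemma sconv_unique u x y : sconv u x -> sconv u y -> x = y.
Proof.
move=> ux uy; apply/eqP; rewrite -subr_eq0; apply/eqP/hn_eq0.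
apply: (@small_eq0 _ 2) (hn_ge0 _) _ => e e0.
have [N uN] := ux e e0; have [M uM] := uy e e0.
apply: le_trans (hn_triangle (u (maxn N M)) _ _) _; rewrite hnB.
have := uN (maxn N M) (leq_maxl _ _); have := uM (maxn N M) (leq_maxr _ _).
lra.
Qed.

Lemma sconv_cst x : sconv (fun=> x) x.
Proof. by move=> e e0; exists 0%N => n _; rewrite subrr hn0. Qed.

Definition subspace (M : set H) :=
  M 0 /\ forall a x y, M x -> M y -> M (a *: x + y).

Definition sclosed (M : set H) :=
  forall u x, (forall n, M (u n)) -> sconv u x -> M x.

Lemma subspaceZ M a x : subspace M -> M x -> M (a *: x).
Proof. by move=> [M0 MD] Mx; rewrite -[_ *: _]addr0; apply: MD. Qed.

Lemma subspaceD M x y : subspace M -> M x -> M y -> M (x + y).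
Proof. by move=> [_ MD] Mx My; rewrite -[x]scale1r; apply: MD. Qed.

End HilbertBasics.

Section LinearMaps.
Variables (R : realType) (H H' : hilbertType R) (f : H -> H').
Hypothesis f_linear : linear f.

Lemma linear_add x y : f (x + y) = f x + f y.
Proof. by rewrite -[x]scale1r f_linear !scale1r. Qed.

Lemma linear_zero : f 0 = 0.
Proof. by apply: (addrI (f 0)); rewrite -linear_add !addr0. Qed.

Lemma linear_scale a x : f (a *: x) = a *: f x.
Proof. by rewrite -[a *: x]addr0 f_linear linear_zero addr0. Qed.

Lemma linear_sub x y : f (x - y) = f x - f y.
Proof. by rewrite -scaleN1r linear_add linear_scale scaleN1r. Qed.

End LinearMaps.

Section Convergence.
Variables (R : realType) (H H' : hilbertType R).

Lemma hn_dot_eq (x : H) (y : H') :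
  hdot x x = hdot y y -> hn x = hn y.
Proof.
move=> xy; apply/eqP; rewrite -(@eqrXn2 _ 2) ?hn_ge0 //.
by rewrite !hn_sq xy.
Qed.

Lemma sconv_contr (V : H -> H') (c : R) u x :
  (forall x y, hn (V x - V y) <= c * hn (x - y)) ->
  sconv u x -> sconv (V \o u) (V x).
Proof.
move=> Vc ux e e0; have c0 : 0 < `|c| + 1 by rewrite ltr_wpDl.
have [|N uN] := ux (e / (`|c| + 1)); first by rewrite divr_gt0.
exists N => n Nn; apply: le_lt_trans (Vc _ _) _.
have := uN n Nn; rewrite ltr_pdivlMr //; apply: le_lt_trans.
rewrite mulrC ler_wpM2l ?hn_ge0 //; have := ler_norm c; lra.
Qed.

(** Limits are taken in both spaces at once: this is how identities between forms pass to the
    closure of a graph in H * H'. *)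
Lemma sconv_hdot2 u v (x a : H) (y b : H') : sconv u x -> sconv v y ->
  (forall n, hdot (u n) a = hdot (v n) b) -> hdot x a = hdot y b.
Proof.
move=> ux vy uv; apply/eqP; rewrite -subr_eq0 -normr_eq0; apply/eqP.
have dE : `|hdot x a - hdot y b| = (complex.Re `|hdot x a - hdot y b|)%:C%C.
  by rewrite RRe_real ?normr_real.
rewrite dE; congr (_%:C%C); apply: (@small_eq0 _ _ (hn a + hn b)).
  by rewrite -lecR -dE normr_ge0.
move=> e e0; have [N uN] := ux e e0; have [M vM] := vy e e0.
have un := uN _ (leq_maxl N M); have vn := vM _ (leq_maxr N M).
rewrite -lecR -dE (_ : _ - _ = hdot (x - u (maxn N M)) a -
    hdot (y - v (maxn N M)) b); last by rewrite !hdotBl uv; ring.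
apply: le_trans (ler_normB _ _) _; rewrite mulrDl rmorphD /=.
by apply: lerD; apply: le_trans (hdot_le _ _) _;
  rewrite lecR mulrC ler_wpM2l ?hn_ge0 // hnB ltW.
Qed.

Lemma sconvD u v (x y : H) : sconv u x -> sconv v y ->
  sconv (fun n => u n + v n) (x + y).
Proof.
move=> ux vy e e0; have e2 : 0 < e / 2 by rewrite divr_gt0.
have [N uN] := ux _ e2; have [M vM] := vy _ e2.
exists (maxn N M) => n; rewrite geq_max => /andP[Nn Mn].
rewrite opprD addrACA; apply: le_lt_trans (hnD _ _) _.
by rewrite [ltRHS]splitr ltrD ?uN ?vM.
Qed.

End Convergence.

(** * Orthogonal projection onto a closed subspace *)

Section Projection.
Variables (R : realType) (H : hilbertType R).

(** A minimizing sequence for the distance is Cauchy by the parallelogram law, since midpoints stay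
    in M; minimality against multiples of y gives the orthogonality. *)
Lemma projection (M : set H) : subspace M -> sclosed M ->
  forall x, exists2 m, M m & forall y, M y -> hdot (x - m) y = 0.
Proof.
move=> sM cM x.
pose S : set R := [set hn (x - m) ^+ 2 | m in M].
have S0 : S !=set0 by exists (hn (x - 0) ^+ 2); exists 0 => //; case: sM.
have Slb : lbound S 0 by move=> _ [m _ <-]; rewrite exprn_ge0 ?hn_ge0.
have hS : has_inf S by split=> //; exists 0.
pose d := inf S.
have dS m : M m -> d <= hn (x - m) ^+ 2.
  by move=> Mm; apply: ge_inf; [exists 0|exists m].
have /choice[u uP] n : exists m, M m /\ hn (x - m) ^+ 2 < d + n.+1%:R^-1.
  have n0 : 0 < n.+1%:R^-1 :> R by rewrite invr_gt0.
  have [_ [m Mm <-] mlt] := inf_adherent n0 hS.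
  by exists m.
have uc : scauchy u.
  (* By the parallelogram law |u_n - u_m|^2 is less than 2/(n+1) + 2/(m+1), so each reciprocal is
     kept below e^2/4. *)
  move=> e e0; have e8 : 0 < e ^+ 2 / 4 by rewrite divr_gt0 ?exprn_gt0.
  have [N _ NP] := near_infty_natSinv_lt (PosNum e8).
  exists N => m n Nm Nn.
  have [Mm um] := uP m; have [Mn un] := uP n.
  have := NP _ Nm; have := NP _ Nn => /= n4 m4.
  have := parallelogram (x - u m) (x - u n).
  have -> : x - u m - (x - u n) = u n - u m.
    by rewrite opprB addrC subrKA.
  have -> : x - u m + (x - u n) = 2 *: (x - 2^-1 *: (u m + u n)).
    rewrite scalerBr scalerA divff ?pnatr_eq0 // scale1r scaler_nat mulr2n.
    by rewrite opprD addrACA.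
  have -> : (2 : R[i]) = (2 : R)%:C%C by rewrite rmorph_nat.
  rewrite hnZr ger0_norm // exprMn hnB.
  have := @dS (((2 : R)%:C%C)^-1 *: (u m + u n)).
  have Muv : M (((2 : R)%:C%C)^-1 *: (u m + u n)).
    by apply: subspaceZ => //; apply: subspaceD.
  move=> /(_ Muv) dl.
  have h0 := hn_ge0 (u n - u m).
  rewrite -(@ltr_pXn2r _ 2%N) ?nnegrE ?(ltW e0) ?hn_ge0 //.
  rewrite hnB; set q := hn (u n - u m) ^+ 2; rewrite -/q.
  move: dl um un n4 m4; rewrite (_ : 2 ^+ 2 = 4); last by ring.
  move: n.+1%:R^-1 m.+1%:R^-1 (hn (x - u m) ^+ 2) (hn (x - u n) ^+ 2) q.
  by move: (hn _ ^+ 2) (e ^+ 2) => A E p q s t r; lra.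
have [m um] := scauchy_sconv uc.
have Mm : M m by apply: cM um => n; case: (uP n).
(* If the limit m were farther from x than sqrt d, then the u_n within e of m would be farther than
   sqrt d + e, where e is half the gap. *)
have dm : hn (x - m) ^+ 2 <= d.
  rewrite leNgt; apply/negP => dlt.
  have d0 : 0 <= d by apply: lb_le_inf.
  have sd : Num.sqrt d < hn (x - m).
    by rewrite -(@ltr_pXn2r _ 2%N) ?nnegrE ?sqrtr_ge0 ?hn_ge0 // sqr_sqrtr.
  pose e := (hn (x - m) - Num.sqrt d) / 2.
  have e0 : 0 < e by rewrite divr_gt0 // subr_gt0.
  have [N uN] := um e e0.
  have d2 : 0 < (Num.sqrt d + e) ^+ 2 - d.
    rewrite -{2}(sqr_sqrtr d0).
    have := sqrtr_ge0 d; move: e0; set s := Num.sqrt d; nra.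
  have [N' _ NP] := near_infty_natSinv_lt (PosNum d2).
  pose n := maxn N N'.
  have := NP n (leq_maxr _ _) => /= nlt.
  have [_ un] := uP n; have := uN n (leq_maxl _ _) => une.
  have : hn (x - m) <= hn (x - u n) + hn (u n - m) by exact: hn_triangle.
  have : hn (x - u n) < Num.sqrt d + e.
    rewrite -(@ltr_pXn2r _ 2%N) ?nnegrE ?hn_ge0 ?addr_ge0 ?sqrtr_ge0 ?(ltW e0) //.
    by apply: lt_trans un _; rewrite addrC -ltrBrDr; exact: nlt.
  move: une; rewrite /e; lra.
exists m => // y My.
have [->|y0] := eqVneq y 0; first by rewrite hdot0r.
have hy : 0 < hn y.
  by rewrite lt_neqAle hn_ge0 andbT eq_sym; apply: contra_neq y0; exact: hn_eq0.
pose w := x - m; pose c := hdot w y.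
(* a y is the component of w along y: removing it lowers |w|^2 by |c|^2 / |y|^2, which minimality
   forbids unless c = 0. *)
pose a := c / (hn y ^+ 2)%:C%C.
have yC : (hn y ^+ 2)%:C%C != 0 :> R[i].
  by apply/eqP => /complexI/eqP; rewrite expf_eq0 /= gt_eqF.
have : hn w ^+ 2 <= hn (w - a *: y) ^+ 2.
  apply: le_trans dm _; rewrite /w -addrA -opprD; apply: dS.
  by rewrite addrC; case: sM => _; apply.
change (hn w ^+ 2 <= hn (w - a *: y) ^+ 2 -> c = 0); clearbody w.
rewrite !hn_sq hdotBl !hdotBr !hdotZl !hdotZr (hdotC y w) -/c (hn2E y).
have aE : a * (hn y ^+ 2)%:C%C = c by rewrite /a divfK.
have -> : hdot w w - a^* * c - (a * c^* - a * (a^* * (hn y ^+ 2)%:C%C)) =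
   hdot w w - a * c^*.
  rewrite -{1}aE; ring.
rewrite /a; case: (hdot w w) => w1 w2; case: c @a aE => c1 c2 _ _.
have -> : Complex c1 c2 / (hn y ^+ 2)%:C%C * (Complex c1 c2)^* =
   ((c1 ^+ 2 + c2 ^+ 2) / hn y ^+ 2)%:C%C.
  apply: (mulIf yC); rewrite mulrAC divfK // -rmorphM /= divfK.
    by simpc; congr Complex; ring.
  by rewrite expf_neq0 // gt_eqF.
rewrite /= lerBDl gerDr pmulr_lle0 ?invr_gt0 ?exprn_gt0 //.
move=> cc; have : c1 = 0 /\ c2 = 0 by nra.
by case=> -> ->.
Qed.

Lemma projection_total (M : set H) : subspace M -> sclosed M ->
  (forall x, (forall y, M y -> hdot x y = 0) -> x = 0) -> forall x, M x.
Proof.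
move=> sM cM M0 x; have [m Mm mP] := projection sM cM x.
by have /eqP := M0 _ mP; rewrite subr_eq0 => /eqP ->.
Qed.

End Projection.

(** * Spectral measures *)

Section SpectralMeasureTheory.
Variables (R : realType) (H : hilbertType R) (E : spectral_measure H).
Implicit Types (A B : set (borelC R)) (x y : H).

Lemma pvm_add A x y : measurable A -> E A (x + y) = E A x + E A y.
Proof. by move=> mA; apply: linear_add (pvm_linear E mA) _ _. Qed.

Lemma pvm_zero A : measurable A -> E A 0 = 0.
Proof. by move=> mA; apply: linear_zero (pvm_linear E mA). Qed.

Lemma pvm_scale A a x : measurable A -> E A (a *: x) = a *: E A x.
Proof. by move=> mA; apply: linear_scale (pvm_linear E mA) _ _. Qed.

Lemma pvm_sub A x y : measurable A -> E A (x - y) = E A x - E A y.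
Proof. by move=> mA; apply: linear_sub (pvm_linear E mA) _ _. Qed.

Lemma hdot_pvm A x y : measurable A -> hdot (E A x) y = hdot (E A x) (E A y).
Proof. by move=> mA; rewrite -(pvm_selfadjoint E mA) pvm_idempotent. Qed.

Lemma pvmU A B x : measurable A -> measurable B -> A `&` B = set0 ->
  E (A `|` B) x = E A x + E B x.
Proof.
move=> mA mB AB.
have mF n : measurable (bigcup2 A B n) by case: n => [|[|n]] //=; exact: measurable0.
have tF : trivIset setT (bigcup2 A B) by rewrite -trivIset_bigcup2.
have := sconv_cvg (@pvm_sigma_additive _ _ E _ mF tF x).
rewrite bigcup2E => Ec; apply: (sconv_unique Ec) => e e0.
exists 2%N => n n2; rewrite -(subnKC n2) big_ord_recl big_ord_recl big1 /=.
  by rewrite addr0 subrr hn0.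
by move=> i _; rewrite /bump /= pvm0.
Qed.

Lemma pvm_setD A B x : measurable A -> measurable B ->
  E A x = E (A `&` B) x + E (A `\` B) x.
Proof.
move=> mA mB; rewrite -pvmU ?setUIDK //; [exact: measurableI|exact: measurableD|].
by apply/seteqP; split=> z //= [[_ ?] [_]].
Qed.

Lemma pvm_setC A x : measurable A -> E (~` A) x = x - E A x.
Proof.
move=> mA; have := pvm_setD x measurableT mA.
by rewrite setTI setTD pvmT /= => {2}->; rewrite addrAC subrr add0r.
Qed.

Lemma pvm_pythagoras A x : measurable A ->
  hn x ^+ 2 = hn (E A x) ^+ 2 + hn (E (~` A) x) ^+ 2.
Proof.
move=> mA; rewrite -pythagoras; first by rewrite pvm_setC // addrC subrK.
by rewrite pvm_setC // hdotBr -hdot_pvm // subrr.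
Qed.

Lemma pvm_contr A x : measurable A -> hn (E A x) <= hn x.
Proof.
move=> mA; apply: hn_le_sq; first exact: hn_ge0.
by rewrite (pvm_pythagoras x mA) lerDl exprn_ge0 // hn_ge0.
Qed.

(** Multiplicativity is derived, not assumed. For y in the range of E(B), the vector E(A [|] B) y =
    E(A) y + y has squared norm 3 |E(A) y|^2 + |y|^2, and a projection cannot increase the norm. *)
Lemma pvm_disjoint A B x : measurable A -> measurable B -> A `&` B = set0 ->
  E A (E B x) = 0.
Proof.
move=> mA mB AB; set y := E B x.
have mU : measurable (A `|` B) by exact: measurableU.
have := pvm_contr y mU; rewrite pvmU // {2}/y pvm_idempotent // -/y.
rewrite -(@ler_pXn2r _ 2%N) ?nnegrE ?hn_ge0 // hn_sqD.
rewrite (hdot_pvm y y mA) hn2E /=.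
have := hn_ge0 (E A y) => h0 h1; apply: hn_eq0.
move: h0 h1; set h := hn (E A y); nra.
Qed.

(** Split A along B, then B along A; projections on disjoint sets annihilate each other. *)
Lemma pvmI A B x : measurable A -> measurable B ->
  E A (E B x) = E (A `&` B) x.
Proof.
move=> mA mB; have mI : measurable (A `&` B) by exact: measurableI.
rewrite (pvm_setD (E B x) mA mB) (pvm_disjoint (A := A `\` B)) ?addr0 //.
- rewrite (pvm_setD x mB mA) pvm_add // setIC pvm_idempotent //.
  + rewrite (pvm_disjoint (B := B `\` A)) ?addr0 //.
      by rewrite setIC.
      exact: measurableD.
    by apply/seteqP; split=> z //= [[_ ?] [_]].
  + by rewrite setIC.
- exact: measurableD.
- by apply/seteqP; split=> z //= [[_ ?]].
Qed.

Lemma pvm_comm A B x : measurable A -> measurable B ->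
  E A (E B x) = E B (E A x).
Proof. by move=> mA mB; rewrite !pvmI // setIC. Qed.

Lemma pvm_sub_null A B x : measurable A -> measurable B -> A `<=` B ->
  E B x = 0 -> E A x = 0.
Proof.
by move=> mA mB AB Bx; rewrite -(setIidl AB) -pvmI // Bx pvm_zero.
Qed.

Lemma pvm_null_bigcup (F : (set (borelC R))^nat) x :
  (forall n, measurable (F n)) -> (forall n, E (F n) x = 0) ->
  E (\bigcup_n F n) x = 0.
Proof.
move=> mF F0; rewrite seqDU_bigcup_eq.
have mD n : measurable (seqDU F n).
  by apply: measurableD => //; apply: bigsetU_measurable.
have := sconv_cvg (@pvm_sigma_additive _ _ E _ mD (@trivIset_seqDU _ F) x).
move=> Ec; apply: (sconv_unique Ec) => e e0; exists 0%N => n _.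
rewrite big1 ?subrr ?hn0 // => i _.
by apply: pvm_sub_null (mD i) (mF i) _ (F0 i) => z [].
Qed.

Lemma hdot_pvm_conj A x y : measurable A ->
  hdot (E A y) x = (hdot (E A x) y)^*.
Proof. by move=> mA; rewrite (pvm_selfadjoint E mA) hdotC. Qed.

End SpectralMeasureTheory.

(** * Unitaries that intertwine two spectral measures *)

Section UnitaryFromPairs.
Variables (R : realType) (H H' : hilbertType R).
Variables (E : spectral_measure H) (E' : spectral_measure H').

(** The relations between the pairs (x, u x) when u is a unitary with u E(B) = E'(B) u; for B the
    whole plane they say that u is isometric. *)
Definition compatible (S : set (H * H')) : Prop :=
  forall p q B, S p -> S q -> measurable B ->
    hdot (E B p.1) q.1 = hdot (E' B p.2) q.2.

(** The last clause tests p on the left only: self-adjointness gives the other order by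
    conjugation. *)
Lemma compatible_maximal (S0 : set (H * H')) : compatible S0 ->
  exists S, [/\ S0 `<=` S, compatible S &
    forall p, (forall q B, S q -> measurable B ->
                 hdot (E B p.1) q.1 = hdot (E' B p.2) q.2) ->
      (forall B, measurable B ->
         hdot (E B p.1) p.1 = hdot (E' B p.2) p.2) -> S p].
Proof.
move=> cS0.
(* The sets whose union with S0 is compatible, rather than those that contain S0, so that the empty
   chain is covered. *)
have [F FP totF|S [cS maxS]] :=
  @Zorn_bigcup (H * H')%type [set S | compatible (S `|` S0)].
  move=> p q B [[X FX Xp]|Sp] [[Y FY Yq]|Sq] mB.
  - by have [XY|YX] := totF X Y FX FY;
      [apply: (FP Y) => //; left; [exact: XY|]
      |apply: (FP X) => //; left; [|exact: YX]].
  - by apply: (FP X) => //; [left|right].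
  - by apply: (FP Y) => //; [right|left].
  - exact: cS0.
exists (S `|` S0); split; [by move=> p S0p; right|exact: cS|].
move=> p pS pp; apply: contrapT => nSp.
apply: (maxS (p |` S)); first split.
- by move=> q Sq; right.
- by move=> pSS; apply: nSp; left; apply: pSS; left.
have symp q B : (S `|` S0) q -> measurable B ->
    hdot (E B q.1) p.1 = hdot (E' B q.2) p.2.
  by move=> Sq mB; rewrite [LHS](hdot_pvm_conj _ _ _ mB) [RHS](hdot_pvm_conj _ _ _ mB) pS.
move=> q r B; rewrite -setUA => -[->|Sq] -[->|Sr] mB.
- exact: pp B mB.
- exact: pS r B Sr mB.
- exact: symp q B Sq mB.
- exact: cS q r B Sq Sr mB.
Qed.

(* A maximal compatible set is the graph of the unitary: it is a closed subspace
   of H * H', and so are its projections, because it is isometric. *)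
Lemma unitary_of_pairs (S0 : set (H * H')) : compatible S0 ->
  (forall x, (forall p, S0 p -> hdot x p.1 = 0) -> x = 0) ->
  (forall y, (forall p, S0 p -> hdot y p.2 = 0) -> y = 0) ->
  exists u : H -> H', [/\ unitary u,
    forall B x, measurable B -> u (E B x) = E' B (u x) &
    forall p, S0 p -> u p.1 = p.2].
Proof.
move=> cS0 tot1 tot2; have [S [S0S cS maxS]] := compatible_maximal cS0.
have S_sub a p q : S p -> S q -> S (a *: p.1 + q.1, a *: p.2 + q.2).
  move=> Sp Sq; apply: maxS => [r B Sr mB|B mB] /=;
    rewrite !pvm_linear // !hdotDl !hdotZl; first by rewrite !cS.
  by rewrite !hdotDr !hdotZr !cS.
have S_dot p q : S p -> S q -> hdot p.1 q.1 = hdot p.2 q.2.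
  by move=> Sp Sq; have := cS p q setT Sp Sq measurableT; rewrite !pvmT.
have S_E A p : S p -> measurable A -> S (E A p.1, E' A p.2).
  move=> Sp mA; apply: maxS => [r B Sr mB|B mB] /=; rewrite !pvmI //.
    by apply: cS => //; apply: measurableI.
  have mBA : measurable (B `&` A) by exact: measurableI.
  by rewrite -!(pvm_selfadjoint _ mA) !pvmI ?cS //; apply: measurableI.
have S_lim u v x y : (forall n, S (u n, v n)) -> sconv u x -> sconv v y ->
    S (x, y).
  move=> Suv ux vy.
  have lim q B : S q -> measurable B -> hdot (E B x) q.1 = hdot (E' B y) q.2.
    move=> Sq mB; rewrite !(pvm_selfadjoint _ mB).
    apply: (sconv_hdot2 ux vy) => n; rewrite -!(pvm_selfadjoint _ mB).
    exact: cS (Suv n) Sq mB.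
  apply: maxS => [q B|B mB] /=; first exact: lim.
  (* Compatibility of (x, y) with itself takes a second limit, in its compatibility with each (u n,
     v n). *)
  rewrite !(pvm_selfadjoint _ mB); apply: (sconv_hdot2 ux vy) => n.
  by rewrite [LHS]hdotC [RHS]hdotC (lim _ _ (Suv n)).
pose D1 := [set x | exists y, S (x, y)]; pose D2 := [set y | exists x, S (x, y)].
have S00 : S (0, 0) by apply: maxS => [q B _ mB|B mB] /=;
  rewrite !pvm_zero // !hdot0l.
have sD1 : subspace D1.
  split=> [|a x x' [y Sxy] [y' Sxy']]; first by exists 0.
  by exists (a *: y + y'); apply: (S_sub a _ _ Sxy Sxy').
have sD2 : subspace D2.
  split=> [|a y y' [x Sxy] [x' Sxy']]; first by exists 0.
  by exists (a *: x + x'); apply: (S_sub a _ _ Sxy Sxy').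
have S_diff p q : S p -> S q -> hn (p.1 - q.1) = hn (p.2 - q.2).
  move=> Sp Sq; apply: hn_dot_eq.
  have := S_dot _ _ (S_sub (-1) _ _ Sq Sp) (S_sub (-1) _ _ Sq Sp).
  by rewrite /= !scaleN1r !(addrC (- _)).
have cD1 : sclosed D1.
  move=> u x uD ux; have [v Suv] := choice uD.
  have [|y vy] := @scauchy_sconv _ _ v; last by exists y; apply: S_lim ux vy.
  move=> e e0; have [N uN] := sconv_scauchy ux e0.
  by exists N => m n Nm Nn; rewrite -(S_diff _ _ (Suv m) (Suv n)) uN.
have cD2 : sclosed D2.
  move=> v y vD vy; have [u Suv] := choice vD.
  have [|x ux] := @scauchy_sconv _ _ u; last by exists x; apply: S_lim ux vy.
  move=> e e0; have [N uN] := sconv_scauchy vy e0.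
  by exists N => m n Nm Nn; rewrite (S_diff _ _ (Suv m) (Suv n)) uN.
have allD1 : forall x, D1 x.
  apply: projection_total => // x xP; apply: tot1 => p S0p; apply: xP.
  by exists p.2; apply: S0S; case: p S0p.
have allD2 : forall y, D2 y.
  apply: projection_total => // y yP; apply: tot2 => p S0p; apply: yP.
  by exists p.1; apply: S0S; case: p S0p.
have [u uS] := choice allD1.
have S_fun x y : S (x, y) -> u x = y.
  move=> Sxy; have := S_diff _ _ (uS x) Sxy; rewrite /= subrr hn0 => /esym.
  by move=> /hn_eq0/eqP; rewrite subr_eq0 => /eqP.
exists u; split.
- split.
  + by move=> a x y; apply: S_fun; apply: (S_sub a _ _ (uS x) (uS y)).
  + by move=> x y; rewrite (S_dot _ _ (uS x) (uS y)).
  + apply/seteqP; split=> // y _; have [x Sxy] := allD2 y.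
    by exists x => //; apply: S_fun.
- by move=> B x mB; apply: S_fun; apply: (S_E B _ (uS x) mB).
- by move=> p S0p; apply: S_fun; apply: S0S; case: p S0p.
Qed.

End UnitaryFromPairs.

Section RealForm.
Variables (R : realType) (H : hilbertType R) (E : spectral_measure H).

(* A maximal set on which all the forms <E(B)x, y> are real is the real part of
   a conjugation commuting with E; only its totality is needed. *)
Lemma real_form (k : set H) :
  (forall B x, measurable B -> k x -> k (E B x)) ->
  exists S : set H, [/\ S `<=` k,
    forall x y B, S x -> S y -> measurable B ->
      (hdot (E B x) y)^* = hdot (E B x) y &
    forall x, k x -> (forall y, S y -> hdot x y = 0) -> x = 0].
Proof.
move=> kE.
have [F FP totF|S [[Sk SR] maxS]] := @Zorn_bigcup H [set S | S `<=` k /\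
    forall x y B, S x -> S y -> measurable B ->
      (hdot (E B x) y)^* = hdot (E B x) y].
  split=> [x [X FX Xx]|x y B [X FX Xx] [Y FY Yy] mB].
    by have [+ _] := FP X FX; apply.
  have [XY|YX] := totF X Y FX FY.
    by have [_ +] := FP Y FY; apply=> //; exact: XY.
  by have [_ +] := FP X FX; apply=> //; exact: YX.
have Smax x : k x -> (forall y B, S y -> measurable B ->
    (hdot (E B x) y)^* = hdot (E B x) y) -> S x.
  move=> kx xR; apply: contrapT => nSx; apply: (maxS (x |` S)).
    by split=> [y Sy|xSS]; [right|apply: nSx; apply: xSS; left].
  split=> [y [->//|/Sk//]|y z B [->|Sy] [->|Sz] mB].
  - by rewrite (hdot_pvm E x x mB) hn2E conj_Creal ?complex_real.
  - exact: xR.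
  - by rewrite hdot_pvm_conj // xR // -hdot_pvm_conj // hdot_pvm_conj // xR.
  - exact: SR.
have SE A y : measurable A -> S y -> S (E A y).
  move=> mA Sy; apply: Smax => [|z B Sz mB]; first by apply: kE => //; exact: Sk.
  by rewrite pvmI // SR //; exact: measurableI.
exists S; split=> // x kx x0.
(* If x is orthogonal to S, its forms with S are all 0, hence real, so maximality puts x in S, where
   it is orthogonal to itself. *)
have xE y B : S y -> measurable B -> hdot (E B x) y = 0.
  by move=> Sy mB; rewrite (pvm_selfadjoint _ mB); apply: x0; exact: SE.
have Sx : S x by apply: Smax => // y B Sy mB; rewrite xE // conjC0.
by have := x0 x Sx => /hdotxx_eq0.
Qed.

End RealForm.

(** * Square roots and transport of operators *)

Lemma eq_of_close (R : realType) (c d : R[i]) (C : R) :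
  (forall e, 0 < e -> `|c - d| <= (C * e)%:C%C) -> c = d.
Proof.
move=> cd; apply/eqP; rewrite -subr_eq0 -normr_eq0; apply/eqP.
have dE : `|c - d| = (complex.Re `|c - d|)%:C%C by rewrite RRe_real ?normr_real.
rewrite dE; congr (_%:C%C); apply: (@small_eq0 _ _ C).
  by rewrite -lecR -dE normr_ge0.
by move=> e e0; rewrite -lecR -dE cd.
Qed.

Section SquareRoot.
Variables (R : realType) (H : hilbertType R) (X : H -> H).
Hypothesis X_lin : linear X.
Hypothesis X_sa : forall x y, hdot (X x) y = hdot x (X y).
Hypothesis X_contr : forall x, hn (X x) <= hn x.

(* Y_(n+1) = (X + Y_n^2) / 2 converges to 1 - sqrt (1 - X), and the distances
   between iterates are dominated by those of the same iteration at X = 1 in R,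
   so that no positivity of operators is involved. *)
Fixpoint sqrt_iter (n : nat) (x : H) : H :=
  if n is m.+1 then 2^-1 *: (X x + sqrt_iter m (sqrt_iter m x)) else 0.

Fixpoint sqrt_bound (n : nat) : R :=
  if n is m.+1 then (1 + sqrt_bound m ^+ 2) / 2 else 0.

Local Notation Y := sqrt_iter.
Local Notation b := sqrt_bound.

Lemma sqrt_iter_linear n : linear (Y n).
Proof.
elim: n => [|n IH] a x y /=; first by rewrite scaler0 addr0.
rewrite X_lin !IH scalerA mulrC -scalerA -scalerDr; congr (_ *: _).
by rewrite scalerDr addrACA.
Qed.

Lemma sqrt_iter_comm (P : H -> H) : linear P ->
  (forall x, P (X x) = X (P x)) -> forall n x, P (Y n x) = Y n (P x).
Proof.
move=> lP PX; elim=> [|n IH] x /=; first exact: linear_zero.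
by rewrite linear_scale // linear_add // PX !IH.
Qed.

Lemma sqrt_iter_commX n x : Y n (X x) = X (Y n x).
Proof. by rewrite (sqrt_iter_comm X_lin). Qed.

Lemma sqrt_iter_commY m n x : Y m (Y n x) = Y n (Y m x).
Proof. exact/(sqrt_iter_comm (sqrt_iter_linear m))/sqrt_iter_commX. Qed.

Lemma sqrt_iter_sa n x y : hdot (Y n x) y = hdot x (Y n y).
Proof.
elim: n x y => [|n IH] x y /=; first by rewrite hdot0l hdot0r.
rewrite hdotZl hdotZr hdotDl hdotDr X_sa !IH; congr (_ * _).
by rewrite fmorphV rmorph_nat.
Qed.

Lemma sqrt_bound_ge0 n : 0 <= b n.
Proof. by case: n => //= n; rewrite divr_ge0 // addr_ge0 // sqr_ge0. Qed.

Lemma sqrt_boundS n : b n.+1 = (1 + b n ^+ 2) / 2.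
Proof. by []. Qed.

Lemma sqrt_bound_homo n : b n <= b n.+1.
Proof. by rewrite sqrt_boundS; have := sqr_ge0 (b n - 1); nra. Qed.

Lemma sqrt_bound_le1 n : b n <= 1.
Proof. by elim: n => //= n IH; have := sqrt_bound_ge0 n; nra. Qed.

Lemma sqrt_iter_le n x : hn (Y n x) <= b n * hn x.
Proof.
elim: n x => [|n IH] x /=; first by rewrite hn0 mul0r.
have -> : (2^-1 : R[i]) = (2^-1 : R)%:C%C by rewrite fmorphV rmorph_nat.
rewrite hnZr ger0_norm //.
have := hnD (X x) (Y n (Y n x)); have := X_contr x; have := IH (Y n x).
have := ler_wpM2l (sqrt_bound_ge0 n) (IH x); rewrite mulrA -expr2; lra.
Qed.

Lemma sqrt_iter_contr n x : hn (Y n x) <= hn x.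
Proof.
apply: le_trans (sqrt_iter_le n x) _.
by rewrite ler_piMl ?hn_ge0 ?sqrt_bound_le1.
Qed.

(** The iterates commute, so Y_(n+2) - Y_(n+1) is half of (Y_(n+1) + Y_n)(Y_(n+1) - Y_n), and the
    real sequence b satisfies the same identity. *)
Lemma sqrt_iter_step n x : hn (Y n.+1 x - Y n x) <= (b n.+1 - b n) * hn x.
Proof.
elim: n x => [|n IH] x; first by rewrite /= !subr0; exact: (sqrt_iter_le 1).
set d := Y n.+1 x - Y n x.
have -> : Y n.+2 x - Y n.+1 x = 2^-1 *: (Y n.+1 d + Y n d).
  rewrite /d !(linear_sub (sqrt_iter_linear _)) (sqrt_iter_commY n n.+1).
  rewrite [_ + (_ - Y n (Y n x))]addrA subrK [Y n.+2 x]/= [Y n.+1 x in LHS]/=.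
  by rewrite -scalerBr opprD addrACA subrr add0r.
have -> : (2^-1 : R[i]) = (2^-1 : R)%:C%C by rewrite fmorphV rmorph_nat.
rewrite hnZr ger0_norm //.
have bb : b n.+2 - b n.+1 = 2^-1 * ((b n.+1 + b n) * (b n.+1 - b n)).
  by rewrite (sqrt_boundS n.+1) {2}(sqrt_boundS n); field.
rewrite bb -mulrA ler_wpM2l //.
apply: le_trans (hnD _ _) _.
have := sqrt_iter_le n.+1 d; have := sqrt_iter_le n d.
have := ler_wpM2l (addr_ge0 (sqrt_bound_ge0 n.+1) (sqrt_bound_ge0 n)) (IH x).
by rewrite -/d mulrA mulrDl; lra.
Qed.

Lemma sqrt_iter_diff n k x :
  hn (Y (k + n) x - Y n x) <= (b (k + n) - b n) * hn x.
Proof.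
elim: k => [|k IH]; first by rewrite !subrr hn0 mul0r.
have := hn_triangle (Y (k + n) x) (Y (k.+1 + n) x) (Y n x).
have := sqrt_iter_step (k + n) x; rewrite -addSn; move: IH; lra.
Qed.

Lemma sqrt_bound_cauchy (e : R) : 0 < e ->
  exists N, forall k, b (k + N) - b N < e.
Proof.
move=> e0; pose S := range b.
have hS : has_sup S.
  by split; [exists (b 0), 0%N|exists 1 => _ [n _ <-]; exact: sqrt_bound_le1].
have [_ [N _ <-] bN] := sup_adherent e0 hS; exists N => k.
have : b (k + N) <= sup S by apply: ub_le_sup; [case: hS|exists (k + N)%N].
lra.
Qed.

Lemma sqrt_iter_conv x : exists y, sconv (Y ^~ x) y.
Proof.
apply: scauchy_sconv => e e0; have h1 : 0 < hn x + 1 by rewrite ltr_wpDl ?hn_ge0.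
have e2 : 0 < e / 2 / (hn x + 1) by rewrite !divr_gt0.
have [N NP] := sqrt_bound_cauchy e2; exists N.
have key m : (N <= m)%N -> hn (Y m x - Y N x) < e / 2.
  move=> Nm; rewrite -(subnK Nm); apply: le_lt_trans (sqrt_iter_diff _ _ _) _.
  have := NP (m - N)%N; rewrite ltr_pdivlMr //; apply: le_lt_trans.
  have := sqrt_iter_diff N (m - N) 0.
  have bge : 0 <= b (m - N + N) - b N.
    elim: (m - N)%N => [|k IH]; first by rewrite subrr.
    by apply: le_trans IH _; rewrite lerD2r addSn sqrt_bound_homo.
  by rewrite ler_wpM2l // lerDl.
move=> m n Nm Nn; apply: le_lt_trans (hn_triangle (Y N x) _ _) _.
by rewrite [ltRHS]splitr (hnB (Y N x)) ltrD ?key.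
Qed.

(** The limit L satisfies 2 L = X + L^2, so T = 1 - L has square 1 - X. The last clause is meant for
    spectral projections, which are linear contractions. *)
Lemma sqrt_exists : exists T : H -> H,
  [/\ forall x y, hdot (T x) y = hdot x (T y),
      forall x, T (T x) = x - X x &
      forall P : H -> H, linear P -> (forall x, hn (P x) <= hn x) ->
        (forall x, P (X x) = X (P x)) -> forall x, P (T x) = T (P x)].
Proof.
have [L LP] := choice sqrt_iter_conv.
have L_add x y : L (x + y) = L x + L y.
  apply: (sconv_unique (LP (x + y))).
  have -> : (fun n => Y n (x + y)) = (fun n => Y n x + Y n y).
    by apply/funext => n; rewrite (linear_add (sqrt_iter_linear n)).
  exact: sconvD.
have L_opp x : L (- x) = - L x.
  apply: (addrI (L x)); rewrite -L_add !subrr.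
  by apply: (addrI (L 0)); rewrite -L_add !addr0.
have L_fix x : L x + L x = X x + L (L x).
  have ux : sconv (fun n => X x + Y n (Y n x)) (X x + L (L x)).
    apply: sconvD (sconv_cst _) _ => e e0.
    have e2 : 0 < e / 2 by rewrite divr_gt0.
    have [N uN] := LP x _ e2; have [M uM] := LP (L x) _ e2.
    exists (maxn N M) => n; rewrite geq_max => /andP[Nn Mn].
    apply: le_lt_trans (hn_triangle (Y n (L x)) _ _) _.
    rewrite [ltRHS]splitr; apply: ltrD; last exact: uM.
    rewrite -(linear_sub (sqrt_iter_linear n)).
    exact: le_lt_trans (sqrt_iter_contr _ _) (uN _ Nn).
  apply: sconv_unique ux => e e0; have e2 : 0 < e / 2 by rewrite divr_gt0.
  have [N uN] := sconvD (LP x) (LP x) e0; exists N => n Nn.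
  have := uN n.+1 (leqW Nn).
  rewrite /= -scalerDl (_ : 2^-1 + 2^-1 = 1) ?scale1r //.
  by rewrite [RHS]splitr !mul1r.
have T_add x y : (x + y) - L (x + y) = (x - L x) + (y - L y).
  by rewrite L_add opprD addrACA.
exists (fun x => x - L x); split.
- move=> x y; rewrite hdotBl hdotBr; congr (_ - _).
  apply: (@eq_of_close _ _ _ (hn x + hn y)) => e e0.
  have [N uN] := LP x _ e0; have [M uM] := LP y _ e0.
  have un := uN _ (leq_maxl N M); have vn := uM _ (leq_maxr N M).
  set n := maxn N M in un vn.
  have -> : hdot (L x) y - hdot x (L y) =
      hdot x (Y n y - L y) - hdot (Y n x - L x) y.
    by rewrite hdotBl hdotBr sqrt_iter_sa; ring.
  apply: le_trans (ler_normB _ _) _; rewrite mulrDl rmorphD /=.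
  apply: lerD; apply: le_trans (hdot_le _ _) _; rewrite lecR.
    by rewrite ler_wpM2l ?hn_ge0 // ltW.
  by rewrite mulrC ler_wpM2l ?hn_ge0 // ltW.
- move=> x; rewrite L_add L_opp opprD opprK addrA -(addrA x) -opprD L_fix.
  by rewrite opprD addrA addrNK.
- move=> P lP Pc PX x; rewrite linear_sub //; congr (_ - _).
  apply: (sconv_unique _ (LP (P x))).
  have -> : (fun n => Y n (P x)) = P \o (Y ^~ x).
    by apply/funext => n /=; rewrite -(sqrt_iter_comm lP PX).
  apply: (@sconv_contr _ _ _ P 1) (LP x) => y z.
  by rewrite mul1r -linear_sub.
Qed.

End SquareRoot.

(** * From intertwined spectral measures to intertwined operators *)

Section Transport.
Variable R : realType.
Implicit Types H : hilbertType R.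

Lemma dense_orthogonal H (D : set H) w : dense D ->
  (forall y, D y -> hdot w y = 0) -> w = 0.
Proof.
move=> dD wD; apply/hn_eq0; apply: (@small_eq0 _ _ 1) (hn_ge0 _) _ => e e0.
rewrite mul1r.
have [||y [/= wy Dy]] := dD (ball w e%:C%C).
- by exists w; apply: ballxx; rewrite ltcR.
- by apply: ball_open; rewrite ltcR.
have wye : hn (w - y) < e by move: wy; rewrite -ball_normE /= hnE ltcR.
have [w0|w0] := ltrP 0 (hn w); last by apply: le_trans w0 (ltW _).
rewrite -(ler_pM2l w0) -expr2.
apply: le_trans (_ : hn w * hn (w - y) <= _); last first.
  by rewrite ler_pM2l // ltW.
apply: le_trans (Re_hdot_le _ _); rewrite hdotBr (wD y Dy) subr0 hn_sq.
exact: ler_norm.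
Qed.

(** [spectral_measure_of] gives only the diagonal values of a form; over the complex numbers they
    determine the others. *)
Lemma polarization H H' (N : operator H H) (N' : operator H' H') (u : H -> H') :
  linear_operator N -> linear_operator N' -> linear u ->
  (forall x, dom N x -> dom N' (u x)) ->
  (forall x, dom N x -> hdot (app N' (u x)) (u x) = hdot (app N x) x) ->
  forall x y, dom N x -> dom N y ->
    hdot (app N' (u x)) (u y) = hdot (app N x) y.
Proof.
move=> [_ Nd Nl] [_ Nd' Nl'] lu uD uq x y Dx Dy.
pose f a := hdot (app N' (u (a *: x + y))) (u (a *: x + y)) -
            hdot (app N (a *: x + y)) (a *: x + y).
pose c := hdot (app N' (u x)) (u y) - hdot (app N x) y.
pose d := hdot (app N' (u y)) (u x) - hdot (app N y) x.
(* The diagonal terms of f cancel; a = 1 and a = i then separate c from d. *)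
have fE a : a * c + a^* * d = 0.
  have f0 : f a = 0 by rewrite /f uq ?subrr //; apply: Nd.
  rewrite -f0 /f lu Nl // Nl'; [|exact: uD|exact: uD].
  rewrite !hdotDl !hdotDr !hdotZl !hdotZr !uq // /c /d; ring.
have := fE 1; have := fE 'i; rewrite conjC1 conjCi !mul1r mulNr => /eqP.
rewrite subr_eq0 => /eqP/(mulfI (neq0Ci _)) <- /eqP.
rewrite -mulr2n mulrn_eq0 /= subr_eq0 => /eqP; exact.
Qed.

Lemma unitary_inj H H' (u : H -> H') : unitary u -> injective u.
Proof.
move=> [lu du _] x y uxy; apply/eqP; rewrite -subr_eq0; apply/eqP/hdotxx_eq0.
by rewrite -du linear_sub // uxy subrr hdot0l.
Qed.

Lemma scalar_measure_transport H H' (E : spectral_measure H)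
    (E' : spectral_measure H') (u : H -> H') :
  (forall x y, hdot (u x) (u y) = hdot x y) ->
  (forall B x, measurable B -> u (E B x) = E' B (u x)) ->
  forall x B, scalar_measure E' (u x) B = scalar_measure E x B.
Proof.
move=> du uE x B; rewrite /scalar_measure; case: asboolP => // mB.
by rewrite -uE // du.
Qed.

(** u carries the scalar measures of E to those of E', so it matches the domains and, by
    polarization, the forms; density of the domain turns equal forms into equal vectors. *)
Lemma operator_transport H H' (N : operator H H) (N' : operator H' H')
    (E : spectral_measure H) (E' : spectral_measure H') (u : H -> H') :
  linear_operator N -> linear_operator N' -> dense (dom N) ->
  spectral_measure_of N E -> spectral_measure_of N' E' -> unitary u ->
  (forall B x, measurable B -> u (E B x) = E' B (u x)) ->
  (forall x, dom N x <-> dom N' (u x)) /\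
  (forall x, dom N x -> app N' (u x) = u (app N x)).
Proof.
move=> lN lN' dN [NE Nq] [NE' Nq'] [lu du ru] uE.
have mu x : forall B, measurable B -> B `<=` setT ->
    scalar_measure E' (u x) B = scalar_measure E x B.
  by move=> B _ _; apply: scalar_measure_transport.
have domE x : dom N x <-> dom N' (u x).
  by rewrite NE NE' /= (eq_measure_integral _ (mu x)).
(* Surjectivity of u pulls the difference back to H, where it is tested against the dense domain of
   N. *)
split=> // x Dx; have [w _ uw] : range u (app N' (u x)) by rewrite ru.
apply/eqP; rewrite -subr_eq0 -uw; apply/eqP.
have lu' : forall v v', u (v - v') = u v - u v'.
  exact: linear_sub.
have u0 : u 0 = 0 by exact: linear_zero.
rewrite -lu' (_ : w - _ = 0) //; apply: (dense_orthogonal dN) => y Dy.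
rewrite hdotBl -(du w) uw; apply/eqP; rewrite subr_eq0; apply/eqP.
apply: (polarization lN lN' lu) => // [z /domE //|z Dz].
rewrite Nq // Nq' -?domE //; congr Complex; congr fine;
  exact: eq_measure_integral _ (mu z).
Qed.

End Transport.

(** * The spectral measure of an operator *)

Section AlmostBounded.
Context d (T : measurableType d) (R : realType).
Variable mu : {measure set T -> \bar R}.
Hypothesis mu_fin : (mu setT < +oo)%E.

Lemma ae_bounded_integral (f : T -> R) (S : set T) (M : R) :
  measurable_fun setT f -> measurable S -> mu (~` S) = 0%E -> 0 <= M ->
  (forall z, S z -> `|f z| <= M) ->
  (\int[mu]_z `|(f z)%:E| <= M%:E * mu setT)%E.
Proof.
move=> mf mS S0 M0 fM.
apply: (integral_le_bound M%:E) => //; first exact/measurable_EFinP.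
exists (~` S); split=> //; first exact: measurableC.
move=> z /= fz; apply: contrapT => /= /contrapT Sz; apply: fz => _.
by rewrite lee_fin fM.
Qed.

Lemma ae_bounded_integrable (f : T -> R) (S : set T) (M : R) :
  measurable_fun setT f -> measurable S -> mu (~` S) = 0%E -> 0 <= M ->
  (forall z, S z -> `|f z| <= M) -> mu.-integrable setT (EFin \o f).
Proof.
move=> mf mS S0 M0 fM; apply/integrableP; split; first exact/measurable_EFinP.
apply: le_lt_trans (ae_bounded_integral mf mS S0 M0 fM) _.
by rewrite lte_mul_pinfty.
Qed.

Lemma ae_close_Rintegral (f : T -> R) (S : set T) (r h : R) :
  measurable_fun setT f -> measurable S -> mu (~` S) = 0%E -> 0 <= h ->
  (forall z, S z -> `|f z - r| <= h) ->
  `|\int[mu]_z f z - r * fine (mu setT)| <= h * fine (mu setT).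
Proof.
move=> mf mS S0 h0 fr.
have mfin : mu setT \is a fin_num by rewrite ge0_fin_numE.
have If : mu.-integrable setT (EFin \o f).
  apply: (ae_bounded_integrable mf mS S0 (M := `|r| + h)) => [|z Sz].
    by rewrite addr_ge0.
  by have := fr z Sz; have := ler_distD r (f z) 0; rewrite !subr0; lra.
have Ir : mu.-integrable setT (EFin \o cst r).
  apply: (@ae_bounded_integrable _ setT `|r|) => //; first by rewrite setCT measure0.
rewrite -Rintegral_cst // -RintegralB //.
apply: le_trans (le_normr_Rintegral _ _) _ => //.
  apply: (@ae_bounded_integrable _ S h) => //.
  by apply: measurable_funB => //; exact: measurable_cst.
have mg : measurable_fun setT (fun z => f z - r).
  by apply: measurable_funB => //; exact: measurable_cst.
have le := ae_bounded_integral mg mS S0 h0 fr.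
have fin : (\int[mu]_z `|(f z - r)%:E|)%E \is a fin_num.
  rewrite ge0_fin_numE; last exact: integral_ge0.
  by apply: le_lt_trans le _; rewrite lte_mul_pinfty.
by move: le; rewrite -(fineK fin) -(fineK mfin) -EFinM lee_fin.
Qed.

End AlmostBounded.

(** * The plane with a real-valued modulus, and its Borel sets *)

Section ComplexPlane.
Variable R : realType.
Implicit Types z w c : R[i].

Definition cabs z : R := complex.Re `|z|.

Lemma cabsE z : `|z| = (cabs z)%:C%C.
Proof. by rewrite /cabs RRe_real ?normr_real. Qed.

Lemma cabs_ge0 z : 0 <= cabs z.
Proof. by rewrite -lecR -cabsE normr_ge0. Qed.

Lemma cabs0 : cabs 0 = 0.
Proof. by apply: complexI; rewrite -cabsE normr0. Qed.

Lemma cabsM z w : cabs (z * w) = cabs z * cabs w.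
Proof. by apply: complexI; rewrite rmorphM /= -!cabsE normrM. Qed.

Lemma cabsD z w : cabs (z + w) <= cabs z + cabs w.
Proof. by rewrite -lecR rmorphD /= -!cabsE ler_normD. Qed.

Lemma cabsN z : cabs (- z) = cabs z.
Proof. by apply: complexI; rewrite -!cabsE normrN. Qed.

Lemma cabsB z w : cabs (z - w) = cabs (w - z).
Proof. by rewrite -cabsN opprB. Qed.

Lemma cabs_triangle w z c : cabs (z - c) <= cabs (z - w) + cabs (w - c).
Proof. by apply: le_trans (cabsD _ _); rewrite addrA subrK. Qed.

Lemma cabs_eq0 z : cabs z = 0 -> z = 0.
Proof. by move=> z0; apply/normr0_eq0; rewrite cabsE z0. Qed.

Lemma cabs_sq z : cabs z ^+ 2 = complex.Re z ^+ 2 + complex.Im z ^+ 2.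
Proof. by rewrite /cabs normc_def /= sqr_sqrtr // addr_ge0 // sqr_ge0. Qed.

Lemma cabs_Re z : `|complex.Re z| <= cabs z.
Proof. by rewrite -lecR -cabsE normc_ge_Re. Qed.

Lemma cabs_Im z : `|complex.Im z| <= cabs z.
Proof.
rewrite -(@ler_pXn2r _ 2%N) ?nnegrE ?cabs_ge0 // cabs_sq real_normK ?num_real //.
by rewrite lerDr sqr_ge0.
Qed.

Lemma cabs_le z (r : R) : 0 <= r ->
  complex.Re z ^+ 2 + complex.Im z ^+ 2 <= r ^+ 2 -> cabs z <= r.
Proof.
by move=> r0; rewrite -cabs_sq ler_pXn2r // nnegrE cabs_ge0.
Qed.

Lemma ReB z w : complex.Re (z - w) = complex.Re z - complex.Re w.
Proof. by case: z w => [? ?] [? ?]. Qed.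

Lemma ImB z w : complex.Im (z - w) = complex.Im z - complex.Im w.
Proof. by case: z w => [? ?] [? ?]. Qed.

Lemma openC_cabs (O : set R[i]^o) :
  open O <-> forall z, O z -> exists2 e : R, 0 < e & forall w, cabs (w - z) < e -> O w.
Proof.
split=> [oO z Oz|OP].
  have /nbhs_ballP[e /= e0 eO] : nbhs (z : R[i]^o) O by apply: open_nbhs_nbhs.
  have [e1 eE] := complex_lt_RRe e0; exists (complex.Re e) => // w wz.
  by apply: eO; rewrite -ball_normE /= distrC cabsE eE ltcR.
rewrite openE => z /OP[e e0 eO]; apply/nbhs_ballP; exists e%:C%C => /=.
  by rewrite ltcR.
move=> w; rewrite -ball_normE /= distrC cabsE ltcR; exact: eO.
Qed.

Lemma borelC_open (O : set (borelC R)) :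
  (forall z, O z -> exists2 e : R, 0 < e & forall w, cabs (w - z) < e -> O w) ->
  measurable O.
Proof. by move/openC_cabs => oO; exact: sub_sigma_algebra. Qed.

Lemma borelC_measurable_realfun (f : R[i] -> R) :
  (forall z (e : R), 0 < e -> exists2 t : R, 0 < t &
     forall w, cabs (w - z) < t -> `|f w - f z| < e) ->
  measurable_fun setT (f : borelC R -> R).
Proof.
move=> fc; apply: (measurability _ (RGenOpens.measurableE R)).
move=> _ [_ [x [y ->] <-]]; rewrite setTI; apply: borelC_open => z /=.
rewrite in_itv /= => /andP[xz zy].
have [|t t0 tP] := fc z (Num.min (f z - x) (y - f z)).
  by rewrite lt_min !subr_gt0 xz zy.
exists t => // w /tP; rewrite lt_min !ltr_norml => /andP[/andP[h1 h2] /andP[h3 h4]].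
by rewrite in_itv /=; apply/andP; split; lra.
Qed.

Lemma measurable_Re : measurable_fun setT (@complex.Re R : borelC R -> R).
Proof.
apply: borelC_measurable_realfun => z e e0; exists e => // w; apply: le_lt_trans.
by rewrite -ReB cabs_Re.
Qed.

Lemma measurable_Im : measurable_fun setT (@complex.Im R : borelC R -> R).
Proof.
apply: borelC_measurable_realfun => z e e0; exists e => // w; apply: le_lt_trans.
by rewrite -ImB cabs_Im.
Qed.

End ComplexPlane.

(** * Operators and their spectral projections *)

Section NormalPart.
Variables (R : realType) (H : hilbertType R) (N : operator H H).
Variable E : spectral_measure H.
Hypothesis N_lin : linear_operator N.
Hypothesis N_dense : dense (dom N).
Hypothesis N_E : spectral_measure_of N E.
Implicit Types (x y : H) (S : set (borelC R)).

Lemma scaler_half x : 2^-1 *: (x + x) = x.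
Proof.
rewrite scalerDr -scalerDl (_ : 2^-1 + 2^-1 = 1) ?scale1r //.
by rewrite [RHS]splitr !mul1r.
Qed.

Lemma dom0 : dom N 0. Proof. by case: N_lin. Qed.

Lemma domD x y : dom N x -> dom N y -> dom N (x + y).
Proof. by move=> Dx Dy; rewrite -[x]scale1r; case: N_lin => _ + _; apply. Qed.

Lemma domZ a x : dom N x -> dom N (a *: x).
Proof.
by move=> Dx; rewrite -[_ *: _]addr0; case: N_lin => + + _ => h; apply.
Qed.

Lemma appD x y : dom N x -> dom N y -> app N (x + y) = app N x + app N y.
Proof.
case: N_lin => _ _ h Dx Dy.
by rewrite -{1}[x]scale1r h // scale1r.
Qed.

Lemma app0 : app N 0 = 0.
Proof.
apply: (addrI (app N 0)); rewrite -appD ?addr0 //; exact: dom0.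
Qed.

Lemma appZ a x : dom N x -> app N (a *: x) = a *: app N x.
Proof.
move=> Dx; rewrite -[a *: x]addr0; case: N_lin => D0 _ h.
by rewrite h // app0 addr0.
Qed.

Lemma appB x y : dom N x -> dom N y -> app N (x - y) = app N x - app N y.
Proof.
move=> Dx Dy; rewrite appD //; last by rewrite -scaleN1r; apply: domZ.
by rewrite -scaleN1r appZ // scaleN1r.
Qed.

(** 2 E(A) - 1 is a self-adjoint involution. *)
Lemma pvm_reflection_unitary A : measurable A ->
  unitary (fun x => E A x + E A x - x).
Proof.
move=> mA; split.
- move=> a x y; rewrite pvm_linear // opprD (addrACA (a *: E A x) (E A y)) [LHS]addrACA.
  by rewrite -scalerDr -scalerBr.
- move=> x y; rewrite !(hdotBl, hdotBr, hdotDl, hdotDr).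
  by rewrite -(pvm_selfadjoint _ mA) pvm_idempotent //
     -(pvm_selfadjoint _ mA); ring.
- apply/seteqP; split=> // x _; exists (E A x + E A x - x) => //.
  rewrite pvm_sub // pvm_add // !pvm_idempotent //.
  by rewrite addrK opprB addrC subrK.
Qed.

(* The reflection E(A) - E(~A) preserves every scalar measure. *)
Lemma operator_pvm A x : measurable A -> dom N x ->
  dom N (E A x) /\ app N (E A x) = E A (app N x).
Proof.
move=> mA Dx.
have [|domQ appQ] := operator_transport N_lin N_lin N_dense N_E N_E
    (pvm_reflection_unitary mA).
- by move=> B y mB; rewrite pvm_sub // pvm_add // !(pvm_comm E y mA mB).
(* E(A) is the mean of the identity and the reflection, which both preserve the domain and commute
   with N. *)
have DQ := (domQ x).1 Dx; have NQ := appQ x Dx.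
have E2 : E A x = 2^-1 *: (x + (E A x + E A x - x)).
  by rewrite addrC subrK scaler_half.
have DE : dom N (E A x) by rewrite E2; apply/domZ/domD.
split=> //; rewrite {1}E2 appZ; last exact: domD.
by rewrite appD // NQ addrC subrK scaler_half.
Qed.

Lemma scalar_measure_total x : scalar_measure E x setT = (hn x ^+ 2)%:E.
Proof. by rewrite /scalar_measure asboolT // pvmT hn_sq. Qed.

Lemma scalar_measure_null S x : measurable S -> E S x = x ->
  scalar_measure E x (~` S) = 0%E.
Proof.
move=> mS Sx; rewrite /scalar_measure asboolT; last exact: measurableC.
by rewrite pvm_setC // Sx subrr hdot0l.
Qed.

(** The scalar measure of x is carried by S, where |z|^2 is bounded. The absolute value of L covers
    an empty S with a negative L. *)
Lemma pvm_bounded_dom S x (L : R) : measurable S -> E S x = x ->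
  (forall z, S z -> cabs z <= L) -> dom N x.
Proof.
move=> mS Sx SL; case: N_E => -> _ /=.
have mx : (scalar_measure E x setT < +oo)%E.
  by rewrite scalar_measure_total ltry.
have := @ae_bounded_integral _ _ _ (scalar_measure E x)
  (fun z => complex.Re z ^+ 2 + complex.Im z ^+ 2) S (`|L| ^+ 2) _ mS
  (scalar_measure_null mS Sx).
move=> /(_ _ _ _)/le_lt_trans h.
have -> : (\int[scalar_measure E x]_z (complex.Re z ^+ 2 + complex.Im z ^+ 2)%:E
  = \int[scalar_measure E x]_z `|(complex.Re z ^+ 2 + complex.Im z ^+ 2)%:E|)%E.
  by apply: eq_integral => z _; rewrite gee0_abs // lee_fin addr_ge0 // sqr_ge0.
apply: h.
- by apply: measurable_funD; apply: measurable_funX;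
    [exact: measurable_Re|exact: measurable_Im].
- by rewrite exprn_ge0.
- move=> z /SL zL; rewrite -cabs_sq ger0_norm ?sqr_ge0 //.
  rewrite ler_pXn2r ?nnegrE ?cabs_ge0 //; exact: le_trans (ler_norm L).
- by rewrite lte_mul_pinfty // ?lee_fin ?exprn_ge0.
Qed.

(** The two parts are bounded apart because [spectral_measure_of] gives them as two real integrals;
    this fits the squares used below. *)
Lemma pvm_form_close S x w (h : R) : measurable S -> E S x = x -> 0 <= h ->
  (forall z, S z -> `|complex.Re z - complex.Re w| <= h /\
                    `|complex.Im z - complex.Im w| <= h) ->
  dom N x /\
  `|complex.Re (hdot (app N x - w *: x) x)| <= h * hn x ^+ 2 /\
  `|complex.Im (hdot (app N x - w *: x) x)| <= h * hn x ^+ 2.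
Proof.
move=> mS Sx h0 Sw.
have Dx : dom N x.
  apply: (pvm_bounded_dom (S := S) (L := h + h + cabs w)) => // z Sz.
  have [zr zi] := Sw z Sz.
  rewrite -[z](subrK w); apply: le_trans (cabsD _ _) _; rewrite lerD2r.
  apply: cabs_le; first by rewrite addr_ge0.
  rewrite ReB ImB -(real_normK (num_real (complex.Re z - _))).
  rewrite -(real_normK (num_real (complex.Im z - _))).
  have := normr_ge0 (complex.Re z - complex.Re w).
  have := normr_ge0 (complex.Im z - complex.Im w).
  by move: zr zi; move: `|_| `|_| => a b; nra.
have mx : (scalar_measure E x setT < +oo)%E.
  by rewrite scalar_measure_total ltry.
split=> //; case: N_E => _ /(_ _ Dx).
rewrite hdotBl hdotZl hn2E => ->.
have hr := @ae_close_Rintegral _ _ _ (scalar_measure E x) mx _ S _ h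
  (@measurable_Re R) mS (scalar_measure_null mS Sx) h0 (fun z Sz => (Sw z Sz).1).
have hi := @ae_close_Rintegral _ _ _ (scalar_measure E x) mx _ S _ h
  (@measurable_Im R) mS (scalar_measure_null mS Sx) h0 (fun z Sz => (Sw z Sz).2).
have fT : fine (scalar_measure E x setT) = hn x ^+ 2.
  by rewrite scalar_measure_total.
move: hr hi; rewrite (_ : fine _ = hn x ^+ 2); last exact: fT.
case: w Sw => w1 w2 _ /=.
by rewrite !mulr0 subr0 add0r.
Qed.

End NormalPart.

(** * Norm bounds for N^2 - c on spectral subspaces *)

Section QuadraticBounds.
Variables (R : realType) (H : hilbertType R) (N : operator H H).
Variable E : spectral_measure H.
Hypothesis N_lin : linear_operator N.
Hypothesis N_dense : dense (dom N).
Hypothesis N_E : spectral_measure_of N E.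
Implicit Types (x y : H) (S : set (borelC R)).

(** For [u] = B v and [t] = B z with B linear, this is polarization, arranged so that only real or
    imaginary parts of diagonal values of the form enter: these are what [pvm_form_close] bounds. *)
Lemma polar_form (u t v z : H) : 4 * complex.Re (hdot u z) =
  complex.Re (hdot (u + t) (v + z)) - complex.Re (hdot (u - t) (v - z)) -
  complex.Im (hdot (u + Complex 0 1 *: t) (v + Complex 0 1 *: z)) +
  complex.Im (hdot (u + Complex 0 (-1) *: t) (v + Complex 0 (-1) *: z)).
Proof.
rewrite !(hdotDl, hdotDr, hdotBl, hdotBr, hdotNl, hdotNr, hdotZl, hdotZr).
have -> : (Complex 0 1)^* = Complex 0 (-1) :> R[i] by [].
have -> : (Complex 0 (-1))^* = Complex 0 (- -1) :> R[i] by [].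
case: (hdot u v) (hdot u z) (hdot t v) (hdot t z) =>
  [a1 a2] [b1 b2] [c1 c2] [d1 d2] /=; ring.
Qed.

(** For B = N - w, polarization and the parallelogram law give Re <B v, z> <= h (|v|^2 + |z|^2) on
    the range of E(S), which B preserves; z is then taken along B y. *)
Lemma pvm_small S w (h : R) y : measurable S -> 0 < h ->
  (forall z, S z -> `|complex.Re z - complex.Re w| <= h /\
                    `|complex.Im z - complex.Im w| <= h) ->
  E S y = y -> hn (app N y - w *: y) <= 2 * h * hn y.
Proof.
move=> mS h0 Sw Sy; pose B v := app N v - w *: v.
have form v (Sv : E S v = v) := pvm_form_close N_E mS Sv (ltW h0) Sw.
have Dv v : E S v = v -> dom N v by move=> /form[].
have SD a v v' : E S v = v -> E S v' = v' -> E S (v + a *: v') = v + a *: v'.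
  by move=> Sv Sv'; rewrite pvm_add // pvm_scale // Sv Sv'.
have BD a v v' : E S v = v -> E S v' = v' -> B (v + a *: v') = B v + a *: B v'.
  move=> Sv Sv'; have Dv1 := Dv _ Sv; have Dv2 := Dv _ Sv'.
  rewrite /B (appD N_lin) //; last exact: domZ.
  rewrite (appZ N_lin) // scalerBr scalerDr opprD addrACA.
  by rewrite !scalerA mulrC.
have SB v : E S v = v -> E S (B v) = B v.
  move=> Sv; have [_ Nv] := operator_pvm N_lin N_dense N_E mS (Dv _ Sv).
  by rewrite /B pvm_sub // pvm_scale // -Nv Sv.
have key v z : E S v = v -> E S z = z ->
    complex.Re (hdot (B v) z) <= h * (hn v ^+ 2 + hn z ^+ 2).
  move=> Sv Sz.
  have [_ [f1 _]] := form _ (SD 1 _ _ Sv Sz).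
  have [_ [f2 _]] := form _ (SD (-1) _ _ Sv Sz).
  have [_ [_ f3]] := form _ (SD (Complex 0 1) _ _ Sv Sz).
  have [_ [_ f4]] := form _ (SD (Complex 0 (-1)) _ _ Sv Sz).
  have p1 := parallelogram v z; have p2 := parallelogram v (Complex 0 1 *: z).
  have iz : hn (Complex 0 1 *: z) = hn z.
    by rewrite hnZ normc_def /= expr0n expr1n add0r sqrtr1 mul1r.
  rewrite iz in p2.
  move: f1 f2 f3 f4; rewrite -!/(B _) !BD // => f1 f2 f3 f4.
  have := polar_form (B v) (B z) v z.
  have iN (x : H) : - (Complex 0 1 *: x) = Complex 0 (-1) *: x.
    by rewrite -scaleNr; congr (_ *: _); apply/eqP; rewrite eq_complex /= oppr0 !eqxx.
  move: f1 f2 f3 f4 p2; rewrite !scale1r !scaleN1r !iN !ler_norml.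
  move=> /andP[_ f1] /andP[f2 _] /andP[f3 _] /andP[_ f4] p2.
  nra.
(* The test vector is l B y: with this l, the bound l |B y|^2 <= h (|y|^2 + l^2 |B y|^2) becomes |B
   y|^2 <= 4 h^2 |y|^2. *)
pose l : R := (2 * h)^-1.
have l0 : 0 < l by rewrite invr_gt0 mulr_gt0.
have lh : l * (2 * h) = 1 by rewrite mulVf // gt_eqF // mulr_gt0.
have := key y (l%:C%C *: B y) Sy; rewrite pvm_scale // SB // => /(_ erefl).
rewrite hdotZr hn2E hnZr ger0_norm ?(ltW l0) // conj_Creal ?complex_real //.
rewrite -rmorphM /= exprMn -/(B y) => hk.
apply: hn_le_sq; first by rewrite !mulr_ge0 // ?hn_ge0 // ltW.
move: hk; set u := hn (B y) ^+ 2; set s := hn y; rewrite !exprMn.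
move=> hk.
have : l * u * (4 * h) <= h * (s ^+ 2 + l ^+ 2 * u) * (4 * h).
  by rewrite ler_wpM2r // mulr_ge0 // ltW.
have -> : l * u * (4 * h) = 2 * u by rewrite -[2 * u]mul1r -lh; ring.
have -> : h * (s ^+ 2 + l ^+ 2 * u) * (4 * h) =
   4 * h ^+ 2 * s ^+ 2 + (l * (2 * h)) ^+ 2 * u by ring.
rewrite lh; lra.
Qed.

Variable c : R[i].

Definition quad y := app N (app N y) - c *: y.

(** For bounded S, N leaves the range of E(S) invariant, so N^2 - c can be iterated there without
    leaving the domain. *)
Lemma fix_dom S (L : R) y : measurable S -> (forall z, S z -> cabs z <= L) ->
  E S y = y -> [/\ dom N y, dom N (app N y), E S (app N y) = app N y &
                   E S (quad y) = quad y].
Proof.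
move=> mS SL Sy; have Dy := pvm_bounded_dom N_E mS Sy SL.
have [_ Ny] := operator_pvm N_lin N_dense N_E mS Dy; rewrite Sy in Ny.
have DNy := pvm_bounded_dom N_E mS (esym Ny) SL.
have [_ NNy] := operator_pvm N_lin N_dense N_E mS DNy; rewrite -Ny in NNy.
by split=> //; rewrite /quad pvm_sub // pvm_scale // -NNy Sy.
Qed.

Lemma hn_dist x y : `|hn x - hn y| <= hn (x - y).
Proof.
rewrite ler_norml; have := hnD (x - y) y; rewrite subrK.
have := hnD (y - x) x; rewrite subrK (hnB y) => h1 h2; apply/andP; split; lra.
Qed.

(** N^2 - w^2 = (N - w)^2 + 2 w (N - w), and N - w has norm at most 2h on the range: hence the error
    (2h)^2 + 2 |w| 2h. *)
Lemma quad_small S w (h L : R) y : measurable S -> 0 < h ->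
  (forall z, S z -> cabs z <= L) ->
  (forall z, S z -> `|complex.Re z - complex.Re w| <= h /\
                    `|complex.Im z - complex.Im w| <= h) ->
  E S y = y ->
  `|hn (quad y) - cabs (w ^+ 2 - c) * hn y| <=
    (4 * h ^+ 2 + 4 * cabs w * h) * hn y.
Proof.
move=> mS h0 SL Sw Sy; have [Dy DNy SNy _] := fix_dom mS SL Sy.
have -> : cabs (w ^+ 2 - c) * hn y = hn ((w ^+ 2 - c) *: y) by rewrite hnZ.
apply: le_trans (hn_dist _ _) _.
pose b := app N y - w *: y.
have Sb : E S b = b by rewrite /b pvm_sub // pvm_scale // SNy Sy.
have -> : quad y - (w ^+ 2 - c) *: y = (app N b - w *: b) + (w + w) *: b.
  rewrite /quad /b (appB N_lin) //; last exact: domZ.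
  rewrite (appZ N_lin) //; apply: hdot_ext => t.
  by rewrite !(hdotBl, hdotDl, hdotZl); ring.
have b1 := pvm_small mS h0 Sw Sy; have b2 := pvm_small mS h0 Sw Sb.
apply: le_trans (hnD _ _) _; rewrite hnZ -/(cabs _).
have := cabsD w w; have := cabs_ge0 w; have := hn_ge0 b; have := hn_ge0 y.
rewrite -/b in b1; move: b1 b2; move: (hn (app N b - _)) (hn b) (hn y).
move: (cabs w) (cabs (w + w)) => W W2 p q r; nra.
Qed.

(* Bounds for N^2 - c on the range of E(S) follow from those on small squares,
   by bisection: the ranges for disjoint parts of S are orthogonal. *)
Definition quad_range S (a b : R) := forall y, E S y = y ->
  a * hn y ^+ 2 <= hn (quad y) ^+ 2 <= b * hn y ^+ 2.

Lemma quad_rangeU S1 S2 (a b L : R) : measurable S1 -> measurable S2 ->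
  S1 `&` S2 = set0 -> (forall z, S1 z -> cabs z <= L) ->
  (forall z, S2 z -> cabs z <= L) ->
  quad_range S1 a b -> quad_range S2 a b -> quad_range (S1 `|` S2) a b.
Proof.
move=> m1 m2 S12 L1 L2 Q1 Q2 y Sy.
have i1 : E S1 (E S1 y) = E S1 y by rewrite pvm_idempotent.
have i2 : E S2 (E S2 y) = E S2 y by rewrite pvm_idempotent.
have ort u v : E S1 u = u -> E S2 v = v -> hdot u v = 0.
  move=> Su Sv; rewrite -Su -Sv (pvm_selfadjoint _ m1).
  by rewrite (pvm_disjoint E v m1 m2 S12) hdot0r.
have yE : y = E S1 y + E S2 y by rewrite -pvmU.
have [D1 DN1 _ q1] := fix_dom m1 L1 i1; have [D2 DN2 _ q2] := fix_dom m2 L2 i2.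
have qE : quad y = quad (E S1 y) + quad (E S2 y).
  rewrite {1}yE /quad !(appD N_lin) // scalerDr opprD addrACA //.
have yy : hn y ^+ 2 = hn (E S1 y) ^+ 2 + hn (E S2 y) ^+ 2.
  by rewrite {1}yE (pythagoras (ort _ _ i1 i2)).
rewrite qE (pythagoras (ort _ _ q1 q2)) yy.
have /andP[h1 h2] := Q1 _ i1; have /andP[h3 h4] := Q2 _ i2.
by apply/andP; split; rewrite mulrDr lerD.
Qed.

(** Half-open, so that a square is the disjoint union of its four quarters. *)
Definition rect (p q h k : R) : set (borelC R) :=
  [set z | p <= complex.Re z < p + h /\ q <= complex.Im z < q + k].

Lemma measurable_rect p q h k : measurable (rect p q h k).
Proof.
have mRe := @measurable_Re R measurableT _ (measurable_itv `[p, (p + h)[).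
have mIm := @measurable_Im R measurableT _ (measurable_itv `[q, (q + k)[).
rewrite (_ : rect p q h k = (setT `&` @complex.Re R @^-1` `[p, (p + h)[) `&`
    (setT `&` @complex.Im R @^-1` `[q, (q + k)[)); first exact: measurableI.
by rewrite !setTI; apply/seteqP; split=> z /=; rewrite !in_itv.
Qed.

Lemma quad_range_double (A : set (borelC R)) (a b L : R) : measurable A ->
  (forall z, A z -> cabs z <= L) -> forall h, 0 < h ->
  (forall p q, quad_range (A `&` rect p q h h) a b) ->
  forall p q, quad_range (A `&` rect p q (h + h) (h + h)) a b.
Proof.
move=> mA AL h h0 Q.
have mI p q k l : measurable (A `&` rect p q k l).
  by apply: measurableI => //; exact: measurable_rect.
have Q2 p q : quad_range (A `&` rect p q (h + h) h) a b.
  rewrite (_ : A `&` _ = (A `&` rect p q h h) `|` (A `&` rect (p + h) q h h)).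
    apply: (@quad_rangeU _ _ _ _ L) => //; try by move=> z [/AL].
    by apply/seteqP; split=> z //= [[_ [/andP[_ +] _]] [_ [/andP[+ _] _]]]; lra.
  rewrite -setIUr; congr (_ `&` _); apply/seteqP; split=> z /=.
    move=> [/andP[h1 h2] hi]; have [h3|h3] := ltrP (complex.Re z) (p + h).
      by left; split=> //; apply/andP.
    by right; split=> //; apply/andP; split=> //; rewrite -addrA.
  by case=> -[/andP[h1 h2] hi]; split=> //; apply/andP; split; lra.
move=> p q.
rewrite (_ : A `&` _ =
    (A `&` rect p q (h + h) h) `|` (A `&` rect p (q + h) (h + h) h)).
  apply: (@quad_rangeU _ _ _ _ L) => //; try by move=> z [/AL].
  by apply/seteqP; split=> z //= [[_ [_ /andP[_ +]]] [_ [_ /andP[+ _]]]]; lra.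
rewrite -setIUr; congr (_ `&` _); apply/seteqP; split=> z /=.
  move=> [hi /andP[h1 h2]]; have [h3|h3] := ltrP (complex.Im z) (q + h).
    by left; split=> //; apply/andP.
  by right; split=> //; apply/andP; split=> //; rewrite -addrA.
by case=> -[hi /andP[h1 h2]]; split=> //; apply/andP; split; lra.
Qed.

Lemma quad_range_grid (A : set (borelC R)) (a b L : R) : measurable A ->
  (forall z, A z -> cabs z <= L) -> forall h, 0 < h ->
  (forall p q, quad_range (A `&` rect p q h h) a b) ->
  forall n p q, quad_range (A `&` rect p q (2 ^+ n * h) (2 ^+ n * h)) a b.
Proof.
move=> mA AL h h0 Q; elim=> [|n IH]; first by rewrite expr0 mul1r.
have -> : 2 ^+ n.+1 * h = 2 ^+ n * h + 2 ^+ n * h by rewrite exprS; ring.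
by apply: (quad_range_double mA AL) => //; rewrite mulr_gt0 // exprn_gt0.
Qed.

(** On the part of A in a small square, N^2 - c is close to the scalar w^2 - c for any w of that
    part. The grid sums these bounds with an error e, which tends to 0 at the end. *)
Lemma quad_between (A : set (borelC R)) (a b L : R) : measurable A ->
  (forall z, A z -> cabs z <= L) -> 0 <= a -> 0 <= b ->
  (forall z, A z -> a <= cabs (z ^+ 2 - c) <= b) ->
  forall y, E A y = y -> a * hn y <= hn (quad y) <= b * hn y.
Proof.
move=> mA AL a0 b0 Aab y Ay; have y0 := hn_ge0 y.
have eps e : 0 < e -> (a - e) * hn y <= hn (quad y) <= (b + e) * hn y.
  move=> e0; pose K := `|L| + 1.
  have K0 : 0 < K by rewrite ltr_wpDl.
  have LK : L < K by have := ler_norm L; rewrite /K; lra.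
  (* For h below this minimum, 4 h^2 + 4 K h <= (4 + 4 K) h <= e. *)
  have d0 : 0 < Num.min 1 (e / (4 + 4 * K)).
    by rewrite lt_min ltr01 divr_gt0 // addr_gt0 // mulr_gt0.
  have [n hn_lt] : exists n, (2 * K) / 2 ^+ n < Num.min 1 (e / (4 + 4 * K)).
    have K2 : 0 < 2 * K by rewrite mulr_gt0.
    have [n _ /(_ n (leqnn n)) /= nP] :=
      near_infty_natSinv_lt (PosNum (divr_gt0 d0 K2)).
    exists n; rewrite -ltr_pdivlMl // mulrC; apply: le_lt_trans nP.
    by rewrite lef_pV2 ?posrE ?exprn_gt0 // -natrX ler_nat ltn_expl.
  (* The side 2K of a square around A, halved n times. *)
  pose h := (2 * K) / 2 ^+ n.
  have h0 : 0 < h by rewrite divr_gt0 ?mulr_gt0 ?exprn_gt0.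
  have he : 4 * h ^+ 2 + 4 * K * h <= e.
    move: hn_lt; rewrite -/h lt_min => /andP[h1].
    rewrite ltr_pdivlMr; last by rewrite addr_gt0 // mulr_gt0.
    by nra.
  have AE : A `&` rect (- K) (- K) (2 ^+ n * h) (2 ^+ n * h) = A.
    apply: setIidl => z /AL zL; rewrite /rect /=.
    have -> : 2 ^+ n * h = 2 * K by rewrite /h mulrC divfK // expf_neq0.
    have := cabs_Re z; have := cabs_Im z; rewrite !ler_norml.
    move=> /andP[h1 h2] /andP[h3 h4].
    by split; apply/andP; split; lra.
  (* The bounds are compared through their squares, so a possibly negative a - e is cut off at 0. *)
  have : quad_range A (Num.max 0 (a - e) ^+ 2) (`|b + e| ^+ 2).
    rewrite -AE; apply: (quad_range_grid mA AL h0) => p q v Av.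
    have v0 := hn_ge0 v.
    have mI : measurable (A `&` rect p q h h).
      by apply: measurableI => //; exact: measurable_rect.
    (* An empty piece offers no point w, but then v = 0. *)
    have [AI0|/set0P[w [Aw [rw iw]]]] := eqVneq (A `&` rect p q h h) set0.
      move: Av; rewrite AI0 pvm0 => <-; rewrite /quad (app0 N_lin) (app0 N_lin).
      by rewrite scaler0 subrr hn0 expr0n /= !mulr0 lexx.
    have /(quad_small mI h0) qs : forall z, (A `&` rect p q h h) z -> cabs z <= L.
      by move=> z [/AL].
    have {}qs := qs w v _ Av.
    have wL := AL w Aw; have w0 := cabs_ge0 w.
    have we : (4 * h ^+ 2 + 4 * cabs w * h) * hn v <= e * hn v.
      by rewrite ler_wpM2r //; apply: le_trans he; rewrite lerD2l; nra.
    have {qs we} : `|hn (quad v) - cabs (w ^+ 2 - c) * hn v| <= e * hn v.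
      apply: le_trans we; apply: qs => z [_ [/andP[z1 z2] /andP[z3 z4]]].
      move: rw iw => /andP[w1 w2] /andP[w3 w4].
      by split; rewrite ler_norml; apply/andP; split; lra.
    rewrite ler_norml => /andP[h1 h2].
    have /andP[wa wb] := Aab w Aw.
    have wa' := ler_wpM2r v0 wa; have wb' := ler_wpM2r v0 wb.
    rewrite -!exprMn !ler_pXn2r ?nnegrE ?mulr_ge0 ?hn_ge0 //;
      [|by rewrite le_max lexx..].
    apply/andP; split; last by rewrite ger0_norm; nra.
    by rewrite /Num.max; case: ifP => _; [nra|rewrite mul0r hn_ge0].
  move=> /(_ y Ay) /andP[]; rewrite -!exprMn => q1 q2.
  have {}q1 : Num.max 0 (a - e) * hn y <= hn (quad y).
    by rewrite -(@ler_pXn2r _ 2%N) ?nnegrE ?mulr_ge0 ?hn_ge0 // le_max lexx.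
  have {}q2 : hn (quad y) <= `|b + e| * hn y.
    by rewrite -(@ler_pXn2r _ 2%N) ?nnegrE ?mulr_ge0 ?hn_ge0.
  rewrite ger0_norm in q2; last by rewrite addr_ge0 // ltW.
  rewrite q2 andbT; apply: le_trans q1; rewrite ler_wpM2r //.
  by rewrite le_max lexx orbT.
have y1 : 0 < hn y + 1 by rewrite ltr_wpDl.
apply/andP; split; apply/ler_addgt0Pr => e e0.
  have /eps/andP[+ _] : 0 < e / (hn y + 1) by rewrite divr_gt0.
  have : e / (hn y + 1) * hn y <= e.
    by rewrite mulrAC ler_pdivrMr // ler_wpM2l ?(ltW e0) // lerDl.
  lra.
have /eps/andP[_] : 0 < e / (hn y + 1) by rewrite divr_gt0.
have : e / (hn y + 1) * hn y <= e.
  by rewrite mulrAC ler_pdivrMr // ler_wpM2l ?(ltW e0) // lerDl.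
lra.
Qed.

End QuadraticBounds.

(** * Growth characterization of spectral subspaces *)

Section Growth.
Variables (R : realType) (H : hilbertType R).

(* The sequence f is (N^2 - c)^n x; quantifying over it avoids speaking of the
   domains of the powers of N. *)
Definition quad_growth (N : operator H H) (c : R[i]) (r : R) (x : H) : Prop :=
  exists (f : nat -> H) (M : R),
    [/\ f 0%N = x,
        forall n, dom N (f n) /\ dom N (app N (f n)),
        forall n, f n.+1 = quad N c (f n) &
        forall n, hn (f n) <= M * r ^+ n].

End Growth.

Section BorelMaps.
Variable R : realType.
Implicit Types (z w c : R[i]) (r : R).

Definition csq (z : borelC R) : borelC R := (z : R[i]) ^+ 2.
Definition cconj (z : borelC R) : borelC R := (z : R[i])^*.
Definition cball c r : set (borelC R) := [set z | cabs (z - c) <= r].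

Lemma borelC_measurable_map (f : borelC R -> borelC R) :
  (forall z (e : R), 0 < e -> exists2 t : R, 0 < t &
     forall w, cabs (w - z) < t -> cabs (f w - f z) < e) ->
  measurable_fun setT f.
Proof.
move=> fc; apply: (@measurability _ _ (borelC R) (borelC R) setT f (@open R[i]^o) erefl).
move=> _ [U oU <-]; rewrite setTI; apply: borelC_open => z /= Uz.
have /openC_cabs/(_ _ Uz)[e e0 eU] := oU.
by have [t t0 tP] := fc z e e0; exists t => // w /tP; exact: eU.
Qed.

Lemma csq_dist z w : cabs (csq w - csq z) = cabs (w - z) * cabs (w + z).
Proof. by rewrite /csq subr_sqr cabsM. Qed.

Lemma measurable_csq : measurable_fun setT csq.
Proof.
apply: borelC_measurable_map => z e e0.
have z0 := cabs_ge0 z.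
have d0 : 0 < 2 * cabs z + 1 by rewrite ltr_wpDl // mulr_ge0.
exists (Num.min 1 (e / (2 * cabs z + 1))) => [|w].
  by rewrite lt_min ltr01 divr_gt0.
rewrite lt_min csq_dist => /andP[w1]; rewrite ltr_pdivlMr //; apply: le_lt_trans.
rewrite ler_wpM2l ?cabs_ge0 //.
have -> : w + z = (w - z) + (z + z) by rewrite addrA subrK.
by have := cabsD (w - z) (z + z); have := cabsD z z; lra.
Qed.

Lemma cconj_dist z w : cabs (cconj w - cconj z) = cabs (w - z).
Proof. by rewrite /cconj -rmorphB /cabs norm_conjC. Qed.

Lemma measurable_cconj : measurable_fun setT cconj.
Proof.
by apply: borelC_measurable_map => z e e0; exists e => // w; rewrite cconj_dist.
Qed.

Lemma measurable_cabsB c : measurable_fun setT (fun z : borelC R => cabs (z - c)).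
Proof.
apply: borelC_measurable_realfun => z e e0; exists e => // w.
apply: le_lt_trans; rewrite ler_norml.
have := cabs_triangle z w c; have := cabs_triangle w z c.
by rewrite (cabsB z w) => h1 h2; apply/andP; split; lra.
Qed.

Lemma measurable_cball c r : measurable (cball c r).
Proof.
have := measurable_cabsB c measurableT (measurable_itv `]-oo, r]).
by rewrite setTI; congr measurable; apply/seteqP; split=> z /=; rewrite in_itv.
Qed.

Lemma measurable_cabs_ge c r : measurable ([set z | r <= cabs (z - c)] : set (borelC R)).
Proof.
have := measurable_cabsB c measurableT (measurable_itv `[r, +oo[).
rewrite setTI; congr measurable; apply/seteqP; split=> z /=; rewrite in_itv /=.
  by rewrite andbT.
by rewrite andbT.
Qed.

Lemma measurable_preimage (f : borelC R -> borelC R) (B : set (borelC R)) :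
  measurable_fun setT f -> measurable B -> measurable (f @^-1` B).
Proof. by move=> mf mB; rewrite -[_ @^-1` _]setTI; apply: mf. Qed.

(** Rational centers and radii make the family countable; codes that name no disc inside O give the
    empty set. *)
Lemma open_cball_bigcup (O : set (borelC R)) :
  (forall z, O z -> exists2 e : R, 0 < e & forall w, cabs (w - z) < e -> O w) ->
  exists F : nat -> set (borelC R), O = \bigcup_n F n /\
    forall n, F n = set0 \/ exists c r, 0 <= r /\ F n = cball c r.
Proof.
move=> oO.
pose ball (p : rat * rat * rat) :=
  cball (Complex (ratr p.1.1) (ratr p.1.2)) (ratr p.2 : R).
pose ok p := `[< 0 <= (ratr p.2 : R) /\ ball p `<=` O >].
pose F n := if (unpickle n : option (rat * rat * rat)) is Some p then
  (if ok p then ball p else set0) else set0.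
exists F; split; last first.
  move=> n; rewrite /F; case: unpickle => [p|]; last by left.
  case: ifPn => [/asboolP[r0 _]|_]; last by left.
  by right; exists (Complex (ratr p.1.1) (ratr p.1.2)), (ratr p.2).
apply/seteqP; split=> [z Oz|z [n _]]; last first.
  rewrite /F; case: unpickle => [p|//].
  by case: ifPn => [/asboolP[_ pO]|//]; apply: pO.
have [e e0 eO] := oO z Oz.
(* A radius q between e/4 and e/2 and a center within e/8 of z in each coordinate: the disc contains
   z and, as q + e/4 < e, stays inside O. *)
have /rat_in_itvoo[q] : e / 4 < e / 2 by lra.
rewrite in_itv /= => /andP[q1 q2].
have /rat_in_itvoo[a] : complex.Re z - e / 8 < complex.Re z + e / 8 by lra.
rewrite in_itv /= => /andP[a1 a2].
have /rat_in_itvoo[b] : complex.Im z - e / 8 < complex.Im z + e / 8 by lra.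
rewrite in_itv /= => /andP[b1 b2].
pose c := Complex (ratr a : R) (ratr b).
have zc : cabs (z - c) <= e / 4.
  by apply: cabs_le; rewrite ?ReB ?ImB /=; nra.
have okp : ok (a, b, q).
  apply/asboolP; split; first by rewrite [_.2]/=; lra.
  move=> w; rewrite /ball /cball -/c => wc; apply: eO.
  have := cabs_triangle c w z; rewrite (cabsB c z).
  have : cabs (w - c) <= ratr q := wc; lra.
exists (pickle (a, b, q)); first exact: I.
rewrite /F (pickleK (a, b, q)) okp.
by change (cabs (z - c) <= ratr q); lra.
Qed.

End BorelMaps.

Arguments csq {R}.
Arguments cconj {R}.

Section GrowthSpectral.
Variables (R : realType) (H : hilbertType R) (N : operator H H).
Variable E : spectral_measure H.
Hypothesis N_lin : linear_operator N.
Hypothesis N_dense : dense (dom N).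
Hypothesis N_E : spectral_measure_of N E.
Variables (c : R[i]) (r : R).
Hypothesis r_ge0 : 0 <= r.

Local Notation D := (csq @^-1` cball c r).

Lemma measurable_disc : measurable D.
Proof.
by apply: measurable_preimage; [exact: measurable_csq|exact: measurable_cball].
Qed.

(** Here |z|^2 <= |c| + r, and t <= t^2 + 1 for real t. *)
Lemma disc_bounded z : D z -> cabs z <= cabs c + r + 1.
Proof.
rewrite /cball /= => zc.
have := cabsD (csq z - c) c; rewrite subrK /csq expr2 cabsM.
have := cabs_ge0 c; have := cabs_ge0 z; move: zc; rewrite /csq; nra.
Qed.

Lemma fix_growth x : E D x = x -> quad_growth N c r x.
Proof.
move=> Dx; pose f n := iter n (quad N c) x.
have fD n : E D (f n) = f n.
  elim: n => [//|n IH].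
  by have [] := fix_dom N_lin N_dense N_E c measurable_disc disc_bounded IH.
exists f, (hn x); split=> // n.
  by have [] := fix_dom N_lin N_dense N_E c measurable_disc disc_bounded (fD n).
elim: n => [|n IH]; first by rewrite expr0 mulr1.
have disc_le (z : R[i]) : D z -> 0 <= cabs (z ^+ 2 - c) <= r.
  by move=> Dz; apply/andP; split; [exact: cabs_ge0|exact: Dz].
have /andP[_] := quad_between N_lin N_dense N_E measurable_disc disc_bounded
  (lexx 0) r_ge0 disc_le (fD n).
by move/le_trans; apply; rewrite exprS mulrCA ler_wpM2l.
Qed.

(** Off D, |z^2 - c| exceeds r: N^2 - c stretches the part of x there by a ratio larger than r at
    each step, which the growth bound forbids. *)
Lemma growth_fix x : quad_growth N c r x -> E D x = x.
Proof.
move=> [f [M [f0 fdom fS fM]]].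
pose s m : R := r + m.+1%:R^-1.
(* The margin s m > r gives a definite ratio and the bound m on |z| makes [quad_between] applicable;
   these sets exhaust the complement of D. *)
pose S m : set (borelC R) :=
  csq @^-1` [set z | s m <= cabs (z - c)] `&` cball 0 m%:R.
have mS m : measurable (S m).
  apply: measurableI; last exact: measurable_cball.
  apply: measurable_preimage; first exact: measurable_csq.
  exact: measurable_cabs_ge.
have SE : ~` D = \bigcup_m S m.
  apply/seteqP; split=> [z|z [m _ [/= zs _]]]; last first.
    rewrite /cball /=; apply/negP; rewrite -ltNge; apply: lt_le_trans zs.
    by rewrite /s ltrDl invr_gt0.
  rewrite /cball /= => /negP; rewrite -ltNge => rz.
  have rz0 : 0 < cabs (csq z - c) - r by rewrite subr_gt0.
  have [k _ kP] := near_infty_natSinv_lt (PosNum rz0).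
  have [l lP] : exists l : nat, cabs z < l%:R.
    by exists (Num.bound (cabs z)); apply: archi_boundP; exact: cabs_ge0.
  exists (maxn k l) => //; split.
    have := kP (maxn k l) (leq_maxl _ _) => /= kl.
    by rewrite /s /= -lerBrDl; exact: ltW kl.
  rewrite /cball /= subr0; apply: le_trans (ltW lP) _.
  by rewrite ler_nat leq_maxr.
suff : E (~` D) x = 0.
  by rewrite pvm_setC; [move/eqP; rewrite subr_eq0 eq_sym => /eqP|exact: measurable_disc].
rewrite SE; apply: pvm_null_bigcup => // m.
have s0 : 0 < s m by rewrite /s ltr_wpDl // invr_gt0.
have rs : r < s m by rewrite /s ltrDl invr_gt0.
pose e n := E (S m) (f n).
have Se n : E (S m) (e n) = e n by rewrite pvm_idempotent.
have Sb z : S m z -> cabs z <= m%:R by move=> [_]; rewrite /cball /= subr0.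
have eS n : e n.+1 = quad N c (e n).
  have [D1 D2] := fdom n.
  have [D3 A3] := operator_pvm N_lin N_dense N_E (mS m) D1.
  have [_ A4] := operator_pvm N_lin N_dense N_E (mS m) D2.
  by rewrite /e fS /quad pvm_sub // pvm_scale // -A4 -A3.
have step n : s m * hn (e n) <= hn (e n.+1).
  have Sab (z : R[i]) : S m z -> s m <= cabs (z ^+ 2 - c) <= m%:R ^+ 2 + cabs c.
    move=> Sz; have zm := Sb z Sz; case: Sz => zs _; apply/andP; split=> //.
    apply: le_trans (cabsD _ _) _; rewrite cabsN lerD2r expr2 cabsM.
    by rewrite expr2 ler_pM ?cabs_ge0.
  have mc0 : 0 <= m%:R ^+ 2 + cabs c by rewrite addr_ge0 ?cabs_ge0 // exprn_ge0.
  rewrite eS.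
  by have /andP[] := quad_between N_lin N_dense N_E (mS m) Sb (ltW s0) mc0 Sab (Se n).
have lower n : s m ^+ n * hn (e 0%N) <= hn (e n).
  elim: n => [|n IH]; first by rewrite expr0 mul1r.
  by apply: le_trans (step n); rewrite exprS -mulrA ler_wpM2l // ltW.
have upper n : s m ^+ n * hn (e 0%N) <= M * r ^+ n.
  by apply: le_trans (lower n) (le_trans _ (fM n)); exact: pvm_contr.
rewrite -f0; apply: hn_eq0; apply/eqP; rewrite eq_le hn_ge0 andbT leNgt.
apply/negP => e0.
have q1 : `|r / s m| < 1.
  by rewrite ger0_norm ?divr_ge0 ?(ltW s0) // ltr_pdivrMr // mul1r.
have /cvgrPdist_lt/(_ _ e0)[n _ /(_ n (leqnn n))] := cvg_geometric M q1.
rewrite sub0r normrN /geometric /= => lt.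
have := upper n; rewrite -ler_pdivlMl ?exprn_gt0 // => up.
have : hn (e 0%N) <= `|M * (r / s m) ^+ n|.
  apply: le_trans up (le_trans _ (ler_norm _)).
  by rewrite expr_div_n mulrCA [s m ^- n * _]mulrC.
by rewrite leNgt lt.
Qed.

Lemma growthP x : quad_growth N c r x <-> E D x = x.
Proof. by split; [exact: growth_fix|exact: fix_growth]. Qed.

End GrowthSpectral.

Section PushForward.
Variables (R : realType) (H : hilbertType R) (E : spectral_measure H).
Variable f : borelC R -> borelC R.
Hypothesis mf : measurable_fun setT f.

Let mp B : measurable B -> measurable (f @^-1` B).
Proof. exact: measurable_preimage. Qed.

(** For f = [csq] it plays the part of the spectral measure of N^2. The term is transparent, so that
    its values convert to those of E. *)
Definition pvm_map : spectral_measure H.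
Proof.
refine (@SpectralMeasure R H (fun B => E (f @^-1` B)) _ _ _ _ _ _).
- by move=> A mA; apply: pvm_linear; apply: mp.
- by move=> A mA; apply: pvm_selfadjoint; apply: mp.
- by move=> A mA; apply: pvm_idempotent; apply: mp.
- by rewrite preimage_set0 pvm0.
- by rewrite preimage_setT pvmT.
- move=> F mF tF x; rewrite preimage_bigcup.
  apply: pvm_sigma_additive; first by move=> n; apply: mp.
  move/trivIsetP: tF => tF; apply/trivIsetP => i j _ _ ij.
  by rewrite -preimage_setI tF // preimage_set0.
Defined.

End PushForward.

(** * Intertwining spectral measures: from discs to Borel sets *)

Section Intertwine.
Variables (R : realType) (H H' : hilbertType R).
Variables (E : spectral_measure H) (E' : spectral_measure H') (V : H -> H').
Hypothesis V_sub : forall x y, V (x - y) = V x - V y.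
Hypothesis V_contr : forall x, hn (V x) <= hn x.

(** The hypotheses on V suit both the linear [corner] and the antilinear [twisted]. Since E(A) E(B)
    = E(A [&] B), the Dynkin system is closed under intersections. *)
Lemma intertwine_sigma_algebra :
  sigma_algebra setT [set B | measurable B /\ forall x, V (E B x) = E' B (V x)].
Proof.
have V0 : V 0 = 0 by rewrite -(subrr 0) V_sub subrr.
have VD x y : V (x + y) = V x + V y.
  by rewrite -{1}[y]opprK -(sub0r y) !V_sub V0 sub0r opprK.
apply: dynkin_setI_sigma_algebra; first split.
- by split=> // x; rewrite !pvmT.
- move=> B [mB BV]; split=> [|x]; first exact: measurableC.
  by rewrite !pvm_setC // V_sub BV.
- move=> F tF FV; split=> [|x].
    by apply: bigcup_measurable => n _; case: (FV n).
  have mF n : measurable (F n) by case: (FV n).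
  have c1 := sconv_cvg (@pvm_sigma_additive _ _ E _ mF tF x).
  have c2 := sconv_cvg (@pvm_sigma_additive _ _ E' _ mF tF (V x)).
  apply: sconv_unique c2.
  have := @sconv_contr _ _ _ V 1 _ _ _ c1.
  have -> : V \o (fun n => \sum_(i < n) E (F i) x) =
      (fun n => \sum_(i < n) E' (F i) (V x)).
    apply/funext => n /=; rewrite (big_morph V VD V0).
    by apply: eq_bigr => i _; case: (FV i).
  by apply=> y z; rewrite -V_sub mul1r.
- move=> A B [mA AV] [mB BV]; split=> [|x]; first exact: measurableI.
  by rewrite -!pvmI // AV BV.
Qed.

Lemma intertwine_borel :
  (forall c r, 0 <= r -> forall x, V (E (cball c r) x) = E' (cball c r) (V x)) ->
  forall B, measurable B -> forall x, V (E B x) = E' B (V x).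
Proof.
move=> VC B mB; suff [] : measurable B /\ forall x, V (E B x) = E' B (V x) by [].
apply: (smallest_sub intertwine_sigma_algebra _ mB) => O oO.
have V0 : V 0 = 0 by rewrite -(subrr 0) V_sub subrr.
have [F [-> FP]] := open_cball_bigcup ((openC_cabs O).1 oO).
have [_ _ Gcup] := intertwine_sigma_algebra.
apply: Gcup => n; have [->|[c [r [r0 ->]]]] := FP n.
  by split=> // x; rewrite !pvm0 V0.
by split=> [|x]; [exact: measurable_cball|exact: VC].
Qed.

End Intertwine.

(** * The set K *)

Section FirstQuadrant.
Variable R : realType.
Implicit Types z w : R[i].

(** The positive imaginary axis is in K and the real axis is not. In this form membership is a
    matter of real inequalities. *)
Lemma K_quadrant : K (R := R) = [set z | 0 <= complex.Re z /\ 0 < complex.Im z].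
Proof.
apply/seteqP; split=> z /=.
  move=> [z0 [t [_ zE] /andP[t0 t2]]].
  have cz : 0 < cabs z.
    rewrite lt_neqAle cabs_ge0 andbT eq_sym; apply: contra_neq z0.
    exact: cabs_eq0.
  have st : 0 < sin t by apply: sin_gt0_pi; rewrite t0 /=; have := pi_gt0 R; lra.
  have ct : 0 <= cos t.
    by apply: cos_ge0_pihalf; rewrite t2 andbT; have := pi_gt0 R; lra.
  rewrite zE cabsE /= !mul0r subr0 addr0; split; first by rewrite mulr_ge0 // ltW.
  by rewrite mulr_gt0.
move=> [rz iz]; have z0 : z != 0 by apply/eqP => z0; move: iz; rewrite z0 ltxx.
have cz : 0 < cabs z.
  rewrite lt_neqAle cabs_ge0 andbT eq_sym; apply: contra_neq z0.
  exact: cabs_eq0.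
(* The argument is acos (Re z / |z|); it is positive because Im z > 0 keeps the quotient below 1. *)
split=> //; set x := complex.Re z / cabs z.
have x0 : 0 <= x by rewrite divr_ge0 // ltW.
have x1 : x < 1.
  rewrite ltr_pdivrMr // mul1r -(@ltr_pXn2r _ 2%N) ?nnegrE ?(ltW cz) //.
  by rewrite cabs_sq ltrDl exprn_gt0.
have xm1 : -1 <= x <= 1 by apply/andP; split; lra.
have t0 : 0 < acos x by apply: acos_gt0; apply/andP; split; lra.
have t2 : acos x <= pi / 2.
  rewrite leNgt; apply/negP => t2.
  have := @ltr_cos R (pi / 2) (acos x).
  have := acos_ge0 xm1; have := acos_lepi xm1; have := pi_gt0 R => p0 h1 h2.
  rewrite !in_itv /= acosK ?in_itv // cos_pihalf t2 (ltNge x) x0 h2 h1.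
  have pp1 : 0 <= @pi R / 2 by lra.
  have pp2 : @pi R / 2 <= @pi R by lra.
  by rewrite pp1 pp2 => /(_ isT isT).
exists (acos x); last by rewrite t0.
split; first by apply/andP; split; have := pi_gt0 R; lra.
rewrite acosK // sin_acos // cabsE.
have sE : cabs z * Num.sqrt (1 - x ^+ 2) = complex.Im z.
  apply/eqP; rewrite -(@eqrXn2 _ 2) ?mulr_ge0 ?sqrtr_ge0 ?(ltW cz) ?(ltW iz) //.
  rewrite exprMn sqr_sqrtr; last by nra.
  apply/eqP; rewrite mulrBr mulr1 -exprMn mulrC divfK ?gt_eqF // cabs_sq.
  by rewrite addrAC subrr add0r.
apply/eqP; rewrite eq_complex /= !mul0r subr0 addr0 sE.
by rewrite eqxx andbT /x mulrC divfK // gt_eqF.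
Qed.

Lemma measurable_K : measurable (K (R := R) : set (borelC R)).
Proof.
rewrite K_quadrant.
have mRe := @measurable_Re R measurableT _ (measurable_itv `[0, +oo[).
have mIm := @measurable_Im R measurableT _ (measurable_itv `]0, +oo[).
rewrite (_ : [set z | _] = (setT `&` @complex.Re R @^-1` `[0, +oo[) `&`
    (setT `&` @complex.Im R @^-1` `]0, +oo[)); first exact: measurableI.
by rewrite !setTI; apply/seteqP; split=> z /=; rewrite !in_itv /= !andbT.
Qed.

Lemma K_cabs_gt0 z : K z -> 0 < cabs z.
Proof.
move=> [z0 _]; rewrite lt_neqAle cabs_ge0 andbT eq_sym.
by apply: contra_neq z0; exact: cabs_eq0.
Qed.

(* The angle between two points of K is at most a right angle. *)
Lemma K_cabsD z w : K z -> K w -> cabs z <= cabs (w + z).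
Proof.
rewrite K_quadrant => -[zr zi] [wr wi].
apply: cabs_le; first exact: cabs_ge0.
rewrite cabs_sq; case: z w zr zi wr wi => [a b] [c d] /= *; nra.
Qed.

(** This is the measurability of the inverse of squaring on K. The class of such sets is a
    sigma-algebra because preimages commute with set operations, so open sets suffice. *)
Lemma K_borel_csq (A0 : set (borelC R)) : measurable A0 ->
  exists B : set (borelC R),
    measurable B /\ A0 `&` K (R := R) = csq @^-1` B `&` K (R := R).
Proof.
pose G := [set A : set (borelC R) | exists B : set (borelC R),
  measurable B /\ A `&` K (R := R) = csq @^-1` B `&` K (R := R)].
have sG : sigma_algebra setT G.
  split.
  - by exists set0; rewrite preimage_set0 !set0I.
  - move=> A [B [mB AB]]; exists (~` B); rewrite setTD; split; first exact: measurableC.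
    apply/seteqP; split=> z [/= h Kz]; split=> //.
      by move=> Bz; apply: h; have [] : (A `&` K (R := R)) z by rewrite AB.
    move=> Az; apply: h.
    by have [] : (csq @^-1` B `&` K (R := R)) z by rewrite -AB.
  - move=> F /choice[B BP]; exists (\bigcup_n B n); split.
      by apply: bigcup_measurable => n _; case: (BP n).
    rewrite preimage_bigcup !setI_bigcupl; apply: eq_bigcupr => n _.
    by case: (BP n).
move=> mA; apply: (smallest_sub sG _ mA) => O /openC_cabs oO.
(* A disc of radius e |z| around z^2: for v and z in K, |v + z| >= |z|, so |v^2 - z^2| < e |z|
   forces |v - z| < e. *)
exists [set w | exists z (e : R), [/\ K z, 0 < e,
  forall v, cabs (v - z) < e -> O v & cabs (w - csq z) < e * cabs z]]; split.
  apply: borelC_open => w [z [e [Kz e0 eO we]]].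
  exists (e * cabs z - cabs (w - csq z)); first by rewrite subr_gt0.
  move=> v vw; exists z, e; split=> //.
  by have := cabs_triangle w v (csq z); lra.
apply/seteqP; split=> z [/= h Kz]; split=> //.
  have [e e0 eO] := oO z h; exists z, e; split=> //.
  by rewrite subrr cabs0 mulr_gt0 // K_cabs_gt0.
case: h => y [e [Ky e0 eO]]; rewrite csq_dist => lt; apply: eO.
have y0 := K_cabs_gt0 Ky; rewrite -(ltr_pM2r y0).
by apply: le_lt_trans lt; rewrite ler_wpM2l ?cabs_ge0 // K_cabsD.
Qed.

End FirstQuadrant.

Section KSupport.
Variables (R : realType) (H : hilbertType R) (E : spectral_measure H).
Hypothesis E_K : E (~` K (R := R)) = (fun=> 0).
Implicit Types (A B : set (borelC R)) (x : H).

Lemma pvm_K A x : measurable A -> E A x = E (A `&` K (R := R)) x.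
Proof.
move=> mA; rewrite (pvm_setD E x mA (@measurable_K R)) -[RHS]addr0; congr (_ + _).
apply: (pvm_sub_null _ _ (_ : _ `<=` ~` K (R := R))).
- by apply: measurableD => //; exact: measurable_K.
- by apply: measurableC; exact: measurable_K.
- by move=> z [].
- by rewrite E_K.
Qed.

Lemma pvm_K_eq A B x : measurable A -> measurable B ->
  A `&` K (R := R) = B `&` K (R := R) -> E A x = E B x.
Proof. by move=> mA mB AB; rewrite (pvm_K x mA) AB -pvm_K. Qed.

Lemma pvm_K_null A x : measurable A -> A `&` K (R := R) = set0 -> E A x = 0.
Proof. by move=> mA AK; rewrite pvm_K // AK pvm0. Qed.

End KSupport.

(** * Invariant subspaces and unitary conjugation *)

Section InvariantSubspace.
Variables (R : realType) (H : hilbertType R) (N : operator H H).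
Variable E : spectral_measure H.
Hypothesis N_lin : linear_operator N.
Hypothesis N_dense : dense (dom N).
Hypothesis N_E : spectral_measure_of N E.
Hypothesis E_K : E (~` K (R := R)) = (fun=> 0).

(** The kernel of N lies in the range of E({0}), and 0 is not in K. *)
Lemma K_supported_inj x : dom N x -> app N x = 0 -> x = 0.
Proof.
move=> Dx Nx.
have gx : quad_growth N 0 0 x.
  (* The sequence x, 0, 0, ... is bounded by |x| 0^n, where 0^0 = 1 admits the first term. *)
  exists (fun n => if n is 0%N then x else 0), (hn x); split=> //.
  - by case=> [|n]; rewrite ?Nx ?(app0 N_lin); split=> //; exact: dom0.
  - by case=> [|n]; rewrite /quad ?Nx !(app0 N_lin) ?(app0 N_lin) scale0r subrr.
  - by case=> [|n]; rewrite ?expr0 ?mulr1 // hn0 exprS mul0r mulr0.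
have := (growthP N_lin N_dense N_E 0 (lexx 0) x).1 gx.
rewrite (pvm_K_null E_K) //; first exact: measurable_disc.
apply/seteqP; split=> // z [] /=; rewrite /cball /= subr0 /csq expr2 cabsM.
by move=> zz /K_cabs_gt0 z0; move: zz; rewrite leNgt mulr_gt0.
Qed.

Variable M : set H.
Hypothesis M_sub : subspace M.
Hypothesis M_closed : sclosed M.
Hypothesis M_E : forall B x, measurable B -> M x -> M (E B x).

Lemma orthogonal_pvm B w : measurable B ->
  (forall m, M m -> hdot w m = 0) -> forall m, M m -> hdot (E B w) m = 0.
Proof. by move=> mB wM m Mm; rewrite (pvm_selfadjoint _ mB) wM //; exact: M_E. Qed.

(** Since Q commutes with E, it commutes with N by [operator_transport]: this expresses that M
    reduces N. *)
Lemma invariant_reflection : exists Q : H -> H, [/\ unitary Q,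
  forall B x, measurable B -> Q (E B x) = E B (Q x),
  forall m, M m -> Q m = m &
  forall w, (forall m, M m -> hdot w m = 0) -> Q w = - w].
Proof.
pose S0 : set (H * H) := [set p | (M p.1 /\ p.2 = p.1) \/
  ((forall m, M m -> hdot p.1 m = 0) /\ p.2 = - p.1)].
have ort B m w : measurable B -> M m -> (forall m, M m -> hdot w m = 0) ->
    hdot (E B m) w = 0.
  by move=> mB Mm wM; apply: hdot_eq0C; apply: wM; exact: M_E.
have EN B w : measurable B -> E B (- w) = - E B w.
  by move=> mB; rewrite -scaleN1r pvm_scale // scaleN1r.
have split0 x : (forall m, M m -> hdot x m = 0) ->
    (forall w, (forall m, M m -> hdot w m = 0) -> hdot x w = 0) -> x = 0.
  by move=> xM xw; apply: hdotxx_eq0; exact: xw.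
have [|x xS|x xS|Q [uQ QE QS]] := @unitary_of_pairs _ _ _ E E S0.
- move=> [p1 p2] [q1 q2] B [[/= Mp ->]|[/= wp ->]] [[/= Mq ->]|[/= wq ->]] mB //=.
  + by rewrite hdotNr ort // oppr0.
  + by rewrite EN // hdotNl orthogonal_pvm // oppr0.
  + by rewrite EN // hdotNl hdotNr opprK.
- apply: split0 => [m Mm|w wM]; first by apply: (xS (m, m)); left.
  by apply: (xS (w, - w)); right.
- apply: split0 => [m Mm|w wM]; first by apply: (xS (m, m)); left.
  apply: oppr_inj; rewrite oppr0 -hdotNr; apply: (xS (w, - w)); right; by split.
- exists Q; split=> // [m Mm|w wM]; first by apply: (QS (m, m)); left.
  by apply: (QS (w, - w)); right.
Qed.

(** N is injective and reduced by M, so it can be cancelled: over each disc, N kills the component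
    of y orthogonal to M. The discs bring the vectors into the domain. *)
Lemma invariant_mem y : (forall n, M (app N (E (cball 0 n%:R) y))) -> M y.
Proof.
move=> MN; have [m Mm mw] := projection M_sub M_closed y.
pose w := y - m; have wM : forall v, M v -> hdot w v = 0 by exact: mw.
have [Q [uQ QE Qm Qw]] := invariant_reflection.
have [domQ appQ] := operator_transport N_lin N_lin N_dense N_E N_E uQ QE.
have mB n : measurable (cball 0 n%:R : set (borelC R)) by exact: measurable_cball.
have bB n (z : R[i]) : cball 0 n%:R z -> cabs z <= n%:R.
  by rewrite /cball /= subr0.
suff w0 n : E (cball 0 n%:R) w = 0.
  have : E (\bigcup_n cball 0 n%:R) w = 0 by exact: pvm_null_bigcup.
  rewrite (_ : \bigcup_n _ = setT) ?pvmT; last first.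
    apply/seteqP; split=> // z _; exists (Num.bound (cabs z)) => //.
    by rewrite /cball /= subr0 ltW // archi_boundP // cabs_ge0.
  by move=> /eqP; rewrite subr_eq0 => /eqP ->.
pose v := E (cball 0 n%:R) w; pose yn := E (cball 0 n%:R) y.
pose mn := E (cball 0 n%:R) m.
have fixE x : E (cball 0 n%:R) (E (cball 0 n%:R) x) = E (cball 0 n%:R) x.
  by rewrite pvm_idempotent.
have Dx x : dom N (E (cball 0 n%:R) x).
  exact: (pvm_bounded_dom N_E (mB n) (fixE x) (bB n)).
have vE : v = yn - mn by rewrite /v /w pvm_sub.
have Qyn : Q yn = mn - v.
  have -> : yn = mn + v by rewrite vE addrC subrK.
  have [lQ _ _] := uQ.
  have QmE : Q mn = mn by apply/Qm/M_E.
  have QvE : Q v = - v by apply/Qw/orthogonal_pvm.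
  by rewrite -[mn]scale1r lQ !scale1r QmE QvE.
have NQ : app N (Q yn) = app N yn.
  by rewrite appQ; [exact: Qm (MN n)|exact: Dx].
apply: K_supported_inj; first exact: Dx.
(* Q changes only the sign of v, and N yn, which lies in M, is fixed by Q; hence N (2 v) = 0. *)
have vv : v + v = yn - Q yn.
  by rewrite Qyn opprB addrCA -vE.
have : app N (v + v) = 0.
  rewrite vv (appB N_lin) ?NQ ?subrr //; first exact: Dx.
  by rewrite -domQ; exact: Dx.
rewrite (appD N_lin); [|exact: Dx|exact: Dx].
by move=> vv0; rewrite -[app N _]scaler_half vv0 scaler0.
Qed.

End InvariantSubspace.

Section UnitaryConj.
Variables (R : realType) (H H' : hilbertType R) (U : H -> H').
Hypothesis U_unitary : unitary U.

(** [adjoint] chooses its value with [xget]; nondegeneracy of the inner product identifies the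
    choice. *)
Lemma adjoint_unitary x : dom (adjoint (op_total U)) (U x) /\
  app (adjoint (op_total U)) (U x) = x.
Proof.
have [_ dU _] := U_unitary.
have h : forall v, dom (op_total U) v -> hdot (app (op_total U) v) (U x) = hdot v x.
  by move=> v _; exact: dU.
split; first by exists x.
pose P : set H := [set z | forall v, dom (op_total U) v ->
  hdot (app (op_total U) v) (U x) = hdot v z].
have zP := xgetPex 0 (ex_intro P x h); apply: hdot_ext => v.
by rewrite hdotC [RHS]hdotC -(h v I) -(zP v I).
Qed.

Lemma unitary_conjP (A : operator H H) (B : operator H' H') :
  (unitary_conj U A =op B)%type <->
  (forall x, dom A x <-> dom B (U x)) /\
  (forall x, dom A x -> app B (U x) = U (app A x)).
Proof.
have [_ _ rU] := U_unitary.
have domE x : dom (unitary_conj U A) (U x) <-> dom A x.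
  have [D aE] := adjoint_unitary x.
  split=> [[[_ h] _]|Dx]; first by move: h; rewrite aE.
  by split=> //; split=> //; rewrite aE.
have appE x : app (unitary_conj U A) (U x) = U (app A x).
  by rewrite -{2}(adjoint_unitary x).2.
split=> [[dAB aAB]|[dAB aAB]].
  split=> x; first by rewrite -dAB domE.
  by move=> Dx; rewrite -aAB ?appE // inE domE.
split=> [|y].
  apply/seteqP; split=> y; have [x _ <-] : range U y by rewrite rU.
    by rewrite domE dAB.
  by rewrite -dAB -domE.
rewrite inE; have [x _ <-] : range U y by rewrite rU.
by rewrite domE => Dx; rewrite appE aAB.
Qed.

End UnitaryConj.

(** * Model operators *)

Section Model.
Variables (R : realType) (H1 H2 : hilbertType R).
Variables (N1 : operator H1 H1) (N2 : operator H2 H2).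
Variables (C1 : H1 -> H2) (C2 : H2 -> H1).
Hypothesis hT : model_data N1 N2 C1 C2.

Local Notation H := (hsum H1 H2).
Local Notation T := (model_T N1 N2 C1 C2).

Lemma hsum_hdotE (x y : H) : hdot x y = hdot x.1 y.1 + hdot x.2 y.2.
Proof. by []. Qed.

Lemma hn_hsum (x : H) : hn x ^+ 2 = hn x.1 ^+ 2 + hn x.2 ^+ 2.
Proof. by rewrite !hn_sq hsum_hdotE; case: (hdot x.1 _) (hdot x.2 _) => ? ? [? ?]. Qed.

Lemma hn_fst (x : H) : hn x.1 <= hn x.
Proof. by apply: hn_le_sq; rewrite ?hn_ge0 // hn_hsum lerDl sqr_ge0. Qed.

Lemma hn_snd (x : H) : hn x.2 <= hn x.
Proof. by apply: hn_le_sq; rewrite ?hn_ge0 // hn_hsum lerDr sqr_ge0. Qed.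

Lemma hn_hsum_le (x : H) : hn x <= hn x.1 + hn x.2.
Proof.
apply: hn_le_sq; first by rewrite addr_ge0 // hn_ge0.
by rewrite hn_hsum; have := hn_ge0 x.1; have := hn_ge0 x.2; nra.
Qed.

Lemma model_CK : cancel C1 C2 /\ cancel C2 C1.
Proof.
case: hT => _ _ [_ _ CK] _; split=> x.
  by have := CK ((x, 0) : H); rewrite /model_C /= => -[].
by have := CK ((0, x) : H); rewrite /model_C /= => -[].
Qed.

Lemma model_C1_antilinear (a b : R[i]) x y :
  C1 (a *: x + b *: y) = a^* *: C1 x + b^* *: C1 y.
Proof.
case: hT => _ _ [CL _ _] _.
by have /(congr1 snd) := CL a b ((x, 0) : H) ((y, 0) : H).
Qed.

Lemma model_C2_antilinear (a b : R[i]) x y :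
  C2 (a *: x + b *: y) = a^* *: C2 x + b^* *: C2 y.
Proof.
case: hT => _ _ [CL _ _] _.
by have /(congr1 fst) := CL a b ((0, x) : H) ((0, y) : H).
Qed.

Lemma antilinear_rules (V W : hilbertType R) (C : V -> W) :
  (forall (a b : R[i]) x y, C (a *: x + b *: y) = a^* *: C x + b^* *: C y) ->
  [/\ C 0 = 0, forall x y, C (x + y) = C x + C y,
      forall x y, C (x - y) = C x - C y & forall a x, C (a *: x) = a^* *: C x].
Proof.
move=> CL; have CD x y : C (x + y) = C x + C y.
  by have := CL 1 1 x y; rewrite conjC1 !scale1r.
have C0 : C 0 = 0 by apply: (addrI (C 0)); rewrite -CD !addr0.
have CZ a x : C (a *: x) = a^* *: C x.
  by have := CL a 0 x 0; rewrite scaler0 addr0 C0 scaler0 addr0.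
split=> // x y; rewrite CD -scaleN1r CZ; congr (_ + _).
by rewrite rmorphN1 scaleN1r.
Qed.

(** Real parts agree by expanding |x + y|^2; replacing x by ix gives the imaginary parts, with the
    sign changed by antilinearity. *)
Lemma antilinear_isometry_dot (V W : hilbertType R) (C : V -> W) :
  (forall (a b : R[i]) x y, C (a *: x + b *: y) = a^* *: C x + b^* *: C y) ->
  (forall x, hn (C x) = hn x) -> forall x y, hdot (C x) (C y) = (hdot x y)^*.
Proof.
move=> CL Cn; have [_ CD _ CZ] := antilinear_rules CL.
have re x y : complex.Re (hdot (C x) (C y)) = complex.Re (hdot x y).
  have := hn_sqD x y; have := hn_sqD (C x) (C y); rewrite -CD !Cn; lra.
move=> x y; have r1 := re x y; have := re (Complex 0 1 *: x) y.
rewrite CZ !hdotZl (_ : (Complex 0 1)^* = Complex 0 (-1)) //.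
move: r1; case: (hdot x y) (hdot (C x) (C y)) => [a b] [c d] /= -> h.
by apply/eqP; rewrite eq_complex /= eqxx /=; apply/eqP; lra.
Qed.

Lemma model_C_hn : (forall x, hn (C1 x) = hn x) /\ (forall x, hn (C2 x) = hn x).
Proof.
have [C10 _ _ _] := antilinear_rules model_C1_antilinear.
have [C20 _ _ _] := antilinear_rules model_C2_antilinear.
case: hT => _ _ [_ Cn _] _.
have sq (V W : hilbertType R) (v : V) (w : W) : hn v ^+ 2 = hn w ^+ 2 -> hn v = hn w.
  by move/eqP; rewrite eqrXn2 ?hn_ge0 // => /eqP.
have {}Cn (x : H) : hn (model_C C1 C2 x) = hn x by rewrite /hn Cn.
split=> x; apply: sq.
  have := congr1 (fun t => t ^+ 2) (Cn ((x, 0) : H)); rewrite !hn_hsum /= C20.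
  by rewrite !hn0 expr0n /= add0r addr0.
have := congr1 (fun t => t ^+ 2) (Cn ((0, x) : H)); rewrite !hn_hsum /= C10.
by rewrite !hn0 expr0n /= add0r addr0.
Qed.

Lemma model_C1_dot x y : hdot (C1 x) (C1 y) = (hdot x y)^*.
Proof. exact: (antilinear_isometry_dot model_C1_antilinear model_C_hn.1). Qed.

Lemma model_C2_dot x y : hdot (C2 x) (C2 y) = (hdot x y)^*.
Proof. exact: (antilinear_isometry_dot model_C2_antilinear model_C_hn.2). Qed.

Lemma model_N_linear : linear_operator N1 /\ linear_operator N2.
Proof. by case: hT => -[? _ _ _] [? _ _ _] _ _. Qed.

Lemma model_N1_dense : dense (dom N1).
Proof. by case: hT => -[_ ? _ _] _ _ _. Qed.

Lemma model_dom_C1 x : dom N2 (C1 x) <-> dom N1 x.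
Proof.
have [C10 _ _ _] := antilinear_rules model_C1_antilinear.
have [C20 _ _ _] := antilinear_rules model_C2_antilinear.
have [l1 l2] := model_N_linear; have d1 := dom0 l1; have d2 := dom0 l2.
case: hT => _ _ _ [/(congr1 (fun S => S ((x, 0) : H))) /= dE _].
move: dE; rewrite /model_C /= C20 => dE.
split=> h.
  have : True /\ dom N1 0 /\ dom N2 (C1 x) by [].
  by rewrite dE => -[[]].
have : (dom N1 x /\ dom N2 0) /\ True by [].
by rewrite -dE => -[_ []].
Qed.

Lemma model_dom_C2 y : dom N1 (C2 y) <-> dom N2 y.
Proof. by rewrite -model_dom_C1 model_CK.2. Qed.

Lemma model_app_C1 x : dom N1 x -> app N2 (C1 x) = C1 (app N1 x).
Proof.
move=> Dx; have [l1 l2] := model_N_linear; have d1 := dom0 l1; have d2 := dom0 l2.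
have [C20 _ _ _] := antilinear_rules model_C2_antilinear.
case: hT => _ _ _ [_ /(_ ((x, 0) : H))]; rewrite inE /= /model_C /= C20.
have D2 : dom N2 (C1 x) by apply/model_dom_C1.
by move=> /(_ (conj I (conj d1 D2)))[_ ->].
Qed.

Lemma model_app_C2 y : dom N2 y -> app N1 (C2 y) = C2 (app N2 y).
Proof.
move=> Dy; have D1 : dom N1 (C2 y) by apply/model_dom_C2.
by rewrite -[LHS](model_CK.1) -model_app_C1 // model_CK.2.
Qed.

Lemma model_T_dom (x : H) : dom T x <-> dom N1 x.1 /\ dom N1 (C2 x.2).
Proof.
rewrite /model_T /=; split=> [[_ [? /model_dom_C1 ?]]|[? ?]] //.
by split=> //; split=> //; apply/model_dom_C1.
Qed.

Lemma model_T_app (x : H) : app T x = (app N1 (C2 x.2), app N2 (C1 x.1)).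
Proof. by []. Qed.

Lemma model_T_appE (x : H) : dom N1 x.1 ->
  app T x = (app N1 (C2 x.2), C1 (app N1 x.1)).
Proof. by move=> Dx; rewrite model_T_app model_app_C1. Qed.

(** T^2 acts as N1^2 on H1 and as C1 N1^2 C2 on H2; moving c through the antilinear C2 conjugates
    it. *)
Lemma model_growth c r (x : H) : quad_growth T c r x <->
  quad_growth N1 c r x.1 /\ quad_growth N1 c^* r (C2 x.2).
Proof.
have [C1K C2K] := model_CK.
have [C10 C1D C1B C1Z] := antilinear_rules model_C1_antilinear.
have [C20 C2D C2B C2Z] := antilinear_rules model_C2_antilinear.
have quadE (y : H) : dom N1 y.1 -> dom N1 (C2 y.2) ->
    dom N1 (app N1 y.1) -> dom N1 (app N1 (C2 y.2)) ->
    quad T c y = (quad N1 c y.1, C1 (quad N1 c^* (C2 y.2))).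
  move=> D1 D2 D3 D4; rewrite /quad !model_T_appE //= C1B C1Z conjCK C2K C1K.
  by rewrite /quad.
split=> [[f [M [f0 fD fS fM]]]|[[g [M [g0 gD gS gM]]] [h [M' [h0 hD hS hM]]]]].
  have fD' n : [/\ dom N1 (f n).1, dom N1 (C2 (f n).2),
      dom N1 (app N1 (f n).1) & dom N1 (app N1 (C2 (f n).2))].
    have [/model_T_dom[D1 D2]] := fD n.
    by rewrite model_T_appE // => /model_T_dom[/= D3]; rewrite C1K.
  split.
    exists (fun n => (f n).1), M; split=> [|n|n|n]; rewrite ?f0 //.
    - by case: (fD' n).
    - by have [? ? ? ?] := fD' n; rewrite fS quadE.
    - exact: le_trans (hn_fst _) (fM n).
  exists (fun n => C2 (f n).2), M; split=> [|n|n|n]; rewrite ?f0 //.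
  - by case: (fD' n).
  - by have [? ? ? ?] := fD' n; rewrite fS quadE //= C1K.
  - by rewrite model_C_hn.2; exact: le_trans (hn_snd _) (fM n).
exists (fun n => (g n, C1 (h n)) : H), (M + M'); split=> [|n|n|n].
- by rewrite g0 h0 C2K; case: (x).
- have [? ?] := gD n; have [? ?] := hD n.
  split; first by apply/model_T_dom; rewrite /= C1K.
  by rewrite model_T_appE //; apply/model_T_dom; rewrite /= !C1K.
- have [? ?] := gD n; have [? ?] := hD n.
  by rewrite quadE /= ?C1K // gS hS.
- apply: le_trans (hn_hsum_le _) _; rewrite /= model_C_hn.1 mulrDl.
  exact: lerD.
Qed.

End Model.

(** * The entries of an intertwining unitary *)

Section UnitaryTransport.
Variables (R : realType) (H H' : hilbertType R) (U : H -> H').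
Hypothesis U_unitary : unitary U.

Lemma unitary_sub x y : U (x - y) = U x - U y.
Proof. by case: U_unitary => lU _ _; apply: linear_sub. Qed.

Lemma unitary_scale a x : U (a *: x) = a *: U x.
Proof. by case: U_unitary => lU _ _; apply: linear_scale. Qed.

Lemma unitary_hn x : hn (U x) = hn x.
Proof. by case: U_unitary => _ dU _; apply: hn_dot_eq. Qed.

Lemma unitary_inverse : exists W : H' -> H,
  [/\ unitary W, cancel U W & cancel W U].
Proof.
have [lU dU rU] := U_unitary.
have /choice[W UW] y : exists x, U x = y.
  by have [x _ <-] : range U y by [rewrite rU]; exists x.
have WU : cancel U W by move=> x; apply: (unitary_inj U_unitary); rewrite UW.
exists W; split=> //; split.
- move=> a x y; apply: (unitary_inj U_unitary).
  by rewrite lU !UW.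
- by move=> x y; rewrite -dU !UW.
- by apply/seteqP; split=> // x _; exists (U x).
Qed.

(** P' U (x - P x) comes from a vector in the range of P, to which x - P x is orthogonal; so it
    vanishes. *)
Lemma projection_transport (P : H -> H) (P' : H' -> H') :
  (forall x y, P (x - y) = P x - P y) ->
  (forall x y, hdot (P x) y = hdot x (P y)) -> (forall x, P (P x) = P x) ->
  (forall x y, P' (x - y) = P' x - P' y) ->
  (forall x y, hdot (P' x) y = hdot x (P' y)) ->
  (forall x, P' (P' x) = P' x) ->
  (forall x, P x = x <-> P' (U x) = U x) -> forall x, U (P x) = P' (U x).
Proof.
move=> PB Psa Pi P'B P'sa P'i PP' x; have [lU dU rU] := U_unitary.
have h : P' (U (x - P x)) = 0.
  have [w _ uw] : range U (P' (U (x - P x))) by rewrite rU.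
  have Pw : P w = w by apply/PP'; rewrite uw P'i.
  apply: hdotxx_eq0; rewrite P'sa P'i -uw dU -Pw -Psa PB Pi subrr.
  by rewrite hdot0l.
move: h; rewrite unitary_sub P'B => /eqP; rewrite subr_eq0 => /eqP ->.
by apply/esym/PP'.
Qed.

Lemma growth_transport (T : operator H H) (T' : operator H' H') c r x :
  (forall x, dom T x <-> dom T' (U x)) ->
  (forall x, dom T x -> app T' (U x) = U (app T x)) ->
  quad_growth T c r x -> quad_growth T' c r (U x).
Proof.
move=> dT aT [f [M [f0 fD fS fM]]]; exists (U \o f), M; split=> [|n|n|n] /=.
- by rewrite f0.
- by have [D1 D2] := fD n; split; rewrite ?aT //; apply/dT.
- have [D1 D2] := fD n.
  by rewrite fS /quad unitary_sub unitary_scale aT // aT.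
- by rewrite unitary_hn.
Qed.

End UnitaryTransport.

Section Direction.
Variables (R : realType) (H1 H2 H1' H2' : hilbertType R).
Variables (N1 : operator H1 H1) (N2 : operator H2 H2).
Variables (C1 : H1 -> H2) (C2 : H2 -> H1).
Variables (N1' : operator H1' H1') (N2' : operator H2' H2').
Variables (C1' : H1' -> H2') (C2' : H2' -> H1').
Hypotheses (hT : model_data N1 N2 C1 C2) (hT' : model_data N1' N2' C1' C2').
Variables (E : spectral_measure H1) (E' : spectral_measure H1').
Hypotheses (N_E : spectral_measure_of N1 E) (N_E' : spectral_measure_of N1' E').
Hypotheses (E_K : E (~` K (R := R)) = (fun=> 0)).
Hypotheses (E_K' : E' (~` K (R := R)) = (fun=> 0)).

Local Notation H := (hsum H1 H2).
Local Notation H' := (hsum H1' H2').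
Local Notation T := (model_T N1 N2 C1 C2).
Local Notation T' := (model_T N1' N2' C1' C2').

Variables (U : H -> H') (W : H' -> H).
Hypotheses (uU : unitary U) (uW : unitary W) (UW : cancel U W) (WU : cancel W U).
Hypothesis domU : forall x, dom T x <-> dom T' (U x).
Hypothesis appU : forall x, dom T x -> app T' (U x) = U (app T x).

(* The entry of the matrix of U that maps H1 to H1', and the entry that maps H1
   to H2' followed by C2'; the latter is antilinear. *)
Definition corner (x : H1) : H1' := (U ((x, 0) : H)).1.
Definition twisted (x : H1) : H1' := C2' (U ((x, 0) : H)).2.

Let l1 : linear_operator N1 := (model_N_linear hT).1.
Let l1' : linear_operator N1' := (model_N_linear hT').1.
Let d1 := model_N1_dense hT.
Let d1' := model_N1_dense hT'.

Lemma pair_sub (x y : H1) : ((x - y, 0) : H) = ((x, 0) : H) - (y, 0).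
Proof. by congr pair; rewrite subr0. Qed.

Lemma pair_linear a (x y : H1) :
  ((a *: x + y, 0) : H) = a *: ((x, 0) : H) + (y, 0).
Proof. by congr pair; rewrite /= scaler0 addr0. Qed.

Lemma hn_pair (x : H1) : hn ((x, 0) : H) = hn x.
Proof. by apply: hn_dot_eq; rewrite hsum_hdotE /= hdot0l addr0. Qed.

Lemma corner_linear a x y : corner (a *: x + y) = a *: corner x + corner y.
Proof. by case: uU => lU _ _; rewrite /corner pair_linear lU. Qed.

Lemma corner_sub x y : corner (x - y) = corner x - corner y.
Proof. by rewrite /corner pair_sub unitary_sub. Qed.

Lemma corner_contr x : hn (corner x) <= hn x.
Proof. by rewrite -hn_pair -(unitary_hn uU); exact: hn_fst. Qed.

Lemma twisted_antilinear (a b : R[i]) x y :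
  twisted (a *: x + b *: y) = a^* *: twisted x + b^* *: twisted y.
Proof.
case: uU => lU _ _; rewrite /twisted pair_linear lU.
rewrite -(model_C2_antilinear hT'); congr C2'; rewrite /=; congr (_ + _).
have -> : ((b *: y, 0) : H) = b *: ((y, 0) : H) by congr pair; rewrite /= scaler0.
by rewrite (unitary_scale uU).
Qed.

Lemma twisted_contr x : hn (twisted x) <= hn x.
Proof.
rewrite /twisted (model_C_hn hT').2 -hn_pair -(unitary_hn uU); exact: hn_snd.
Qed.

Lemma twisted_hn x : corner x = 0 -> hn (twisted x) = hn x.
Proof.
move=> x0; rewrite /twisted (model_C_hn hT').2 -hn_pair -(unitary_hn uU).
apply/eqP; rewrite -(@eqrXn2 _ 2) ?hn_ge0 // (hn_hsum (U _)).
by rewrite -/(corner x) x0 hn0 expr0n /= add0r.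
Qed.

(** Both pairs are orthogonal projections whose ranges are cut out by the growth condition for T and
    T', which U and W preserve. *)
Lemma U_disc c r x : 0 <= r ->
  U ((E (csq @^-1` cball c r) x.1, C1 (E (csq @^-1` cball c^* r) (C2 x.2))) : H) =
  ((E' (csq @^-1` cball c r) (U x).1,
    C1' (E' (csq @^-1` cball c^* r) (C2' (U x).2))) : H').
Proof.
move=> r0.
have [C1K C2K] := model_CK hT; have [C1K' C2K'] := model_CK hT'.
have [_ _ C1B _] := antilinear_rules (model_C1_antilinear hT).
have [_ _ C2B _] := antilinear_rules (model_C2_antilinear hT).
have [_ _ C1B' _] := antilinear_rules (model_C1_antilinear hT').
have [_ _ C2B' _] := antilinear_rules (model_C2_antilinear hT').
have mD d : measurable (csq @^-1` cball d r : set (borelC R)).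
  exact: measurable_disc.
pose P (x : H) : H := (E (csq @^-1` cball c r) x.1,
  C1 (E (csq @^-1` cball c^* r) (C2 x.2))).
pose P' (x : H') : H' := (E' (csq @^-1` cball c r) x.1,
  C1' (E' (csq @^-1` cball c^* r) (C2' x.2))).
have PP (y : H) : P y = y <-> quad_growth T c r y.
  rewrite (model_growth hT) (growthP l1 d1 N_E _ r0) (growthP l1 d1 N_E _ r0).
  split=> [yP|[y1 y2]].
    split; first exact: (congr1 fst yP).
    by rewrite -[LHS]C1K; exact: (congr1 (fun t : H => C2 t.2) yP).
  by rewrite /P y1 y2 C2K; case: (y).
have PP' (y : H') : P' y = y <-> quad_growth T' c r y.
  rewrite (model_growth hT') (growthP l1' d1' N_E' _ r0) (growthP l1' d1' N_E' _ r0).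
  split=> [yP|[y1 y2]].
    split; first exact: (congr1 fst yP).
    by rewrite -[LHS]C1K'; exact: (congr1 (fun t : H' => C2' t.2) yP).
  by rewrite /P' y1 y2 C2K'; case: (y).
apply: (@projection_transport _ _ _ U uU P P').
- by move=> y z; rewrite /P /= C2B !pvm_sub // C1B.
- move=> y z; rewrite !hsum_hdotE /= (pvm_selfadjoint E (mD c)); congr (_ + _).
  rewrite -{1}(C2K z.2) -{2}(C2K y.2) !(model_C1_dot hT).
  by rewrite (pvm_selfadjoint E (mD _)).
- by move=> y; rewrite /P /= C1K !pvm_idempotent.
- by move=> y z; rewrite /P' /= C2B' !pvm_sub // C1B'.
- move=> y z; rewrite !hsum_hdotE /= (pvm_selfadjoint E' (mD c)); congr (_ + _).
  rewrite -{1}(C2K' z.2) -{2}(C2K' y.2) !(model_C1_dot hT').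
  by rewrite (pvm_selfadjoint E' (mD _)).
- by move=> y; rewrite /P' /= C1K' !pvm_idempotent.
- move=> y; rewrite PP PP'; split; first exact: growth_transport.
  rewrite -{2}[y]UW; apply: growth_transport => // [z|z Dz].
    by rewrite -{1}[z]WU domU.
  by apply: (unitary_inj uU); rewrite WU -appU ?WU // domU WU.
Qed.

Local Notation F := (pvm_map E (@measurable_csq R)).
Local Notation F' := (pvm_map E' (@measurable_csq R)).

Lemma corner_F B x : measurable B -> corner (F B x) = F' B (corner x).
Proof.
move=> mB; move: B mB x; apply: intertwine_borel.
- exact: corner_sub.
- exact: corner_contr.
move=> c r r0 x; have := @U_disc c r ((x, 0) : H) r0.
have [C10 _ _ _] := antilinear_rules (model_C1_antilinear hT).
have [C20 _ _ _] := antilinear_rules (model_C2_antilinear hT).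
rewrite /= C20 pvm_zero ?C10; last exact: measurable_disc.
by move/(congr1 fst).
Qed.

(** The second component of [U_disc] has the conjugate center; this puts [cconj] on the side of
    F'. *)
Lemma twisted_F B x : measurable B ->
  twisted (F B x) = F' (cconj @^-1` B) (twisted x).
Proof.
move=> mB; have := @intertwine_borel _ _ _ F
  (pvm_map F' (@measurable_cconj R)) twisted.
move=> /(_ _ twisted_contr _ B mB x); apply.
  by have [] := antilinear_rules twisted_antilinear.
move=> c r r0 y; have := @U_disc c r ((y, 0) : H) r0.
have [C10 _ _ _] := antilinear_rules (model_C1_antilinear hT).
have [C20 _ _ _] := antilinear_rules (model_C2_antilinear hT).
rewrite /= C20 pvm_zero ?C10; last exact: measurable_disc.
move/(congr1 (fun t : H' => C2' t.2)); rewrite /= (model_CK hT').1 /twisted => ->.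
congr (E' _ _); apply/seteqP; split=> z; rewrite /cball /=.
  by rewrite -cconj_dist /cconj conjCK.
by rewrite -cconj_dist /cconj conjCK.
Qed.

Lemma csq_measurable B : measurable B -> measurable (csq @^-1` B : set (borelC R)).
Proof. by move=> mB; apply: measurable_preimage => //; exact: measurable_csq. Qed.

(** By [K_borel_csq], E(A) and E'(A) are the values of F and F' at one Borel set. *)
Lemma corner_E A x : measurable A -> corner (E A x) = E' A (corner x).
Proof.
move=> mA; have [B [mB AB]] := K_borel_csq mA; have mS := csq_measurable mB.
rewrite (pvm_K_eq E_K _ mA mS AB) (pvm_K_eq E_K' _ mA mS AB).
exact: corner_F.
Qed.

Lemma measurable_Im_gt0 : measurable ([set z | 0 < complex.Im z] : set (borelC R)).
Proof.
have := @measurable_Im R measurableT _ (measurable_itv `]0, +oo[).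
by rewrite setTI; congr measurable; apply/seteqP; split=> z /=; rewrite in_itv /= andbT.
Qed.

Lemma measurable_Im_lt0 : measurable ([set z | complex.Im z < 0] : set (borelC R)).
Proof.
have := @measurable_Im R measurableT _ (measurable_itv `]-oo, 0[).
by rewrite setTI; congr measurable; apply/seteqP; split=> z /=; rewrite in_itv.
Qed.

Lemma F_lower (V : hilbertType R) (G : spectral_measure V) x :
  G (~` K (R := R)) = (fun=> 0) ->
  pvm_map G (@measurable_csq R) [set z | complex.Im z < 0] x = 0.
Proof.
move=> GK; apply: (pvm_K_null GK); first exact: csq_measurable measurable_Im_lt0.
apply/seteqP; split=> // z [/= zi]; rewrite K_quadrant => -[zr zI].
by move: zi; rewrite /csq; case: z zr zI => a b /= a0 b0; nra.
Qed.

(* Squares of points of K lie in the closed upper half-plane, and [twisted]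
   exchanges the half-planes: what remains is the real axis. *)
Lemma twisted_lower_upper x :
  F' [set z | complex.Im z < 0] (twisted x) = 0 /\
  F' [set z | 0 < complex.Im z] (twisted x) = 0.
Proof.
split; first exact: F_lower.
have := twisted_F x measurable_Im_lt0; rewrite F_lower //.
have [-> _ _ _] := antilinear_rules twisted_antilinear => ->.
congr (E' _ _); apply/seteqP; split=> z /=; rewrite /cconj; case: (csq z) => a b /=;
  by rewrite oppr_lt0.
Qed.

(** By [twisted_lower_upper], F' sees the values of [twisted] only on the real axis, where [cconj]
    is the identity. *)
Lemma twisted_E A x : measurable A -> twisted (E A x) = E' A (twisted x).
Proof.
move=> mA; have [B [mB AB]] := K_borel_csq mA; have mS := csq_measurable mB.
rewrite (pvm_K_eq E_K _ mA mS AB) (pvm_K_eq E_K' _ mA mS AB).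
rewrite -[LHS]/(twisted (F B x)) twisted_F // -[RHS]/(F' B (twisted x)).
set v := twisted x; have [v1 v2] := twisted_lower_upper x.
pose L : set (borelC R) := [set z | complex.Im z < 0] `|` [set z | 0 < complex.Im z].
have mL : measurable L.
  by apply: measurableU; [exact: measurable_Im_lt0|exact: measurable_Im_gt0].
have vL : F' (~` L) v = v.
  rewrite pvm_setC // pvmU; [|exact: measurable_Im_lt0|exact: measurable_Im_gt0|].
    by rewrite v1 v2 addr0 subr0.
  by apply/seteqP; split=> // z [/=]; lra.
have mL' : measurable (~` L) by exact: measurableC.
have mB' : measurable (cconj @^-1` B).
  by apply: measurable_preimage => //; exact: measurable_cconj.
rewrite -vL !pvmI //; congr (F' _ _); apply/seteqP.
have real (z : R[i]) : (~` L) z -> cconj z = z.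
  move=> zL; have z0 : complex.Im z = 0.
    apply/eqP; rewrite eq_le !leNgt.
    by apply/andP; split; apply/negP => h; apply: zL; [right|left].
  rewrite /cconj; case: z z0 {zL} => a b /= ->.
  by apply/eqP; rewrite eq_complex /= oppr0 !eqxx.
by split=> z [/= zB zL]; split=> //; move: zB; rewrite /= real.
Qed.

(** The adjoint of [corner U] is [corner W], so what is proved for U applies to the adjoint with the
    roles exchanged. *)
Lemma corner_adjoint x y : hdot (corner x) y = hdot x (W ((y, 0) : H')).1.
Proof.
have : hdot (U ((x, 0) : H)) ((y, 0) : H') = hdot ((x, 0) : H) (W ((y, 0) : H')).
  by case: uU => _ dU _; rewrite -dU WU.
by rewrite !hsum_hdotE /= hdot0r hdot0l !addr0.
Qed.

Lemma U_twisted x : corner x = 0 -> U ((x, 0) : H) = ((0, C1' (twisted x)) : H').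
Proof.
move=> x0; rewrite /twisted (model_CK hT').2; move: x0; rewrite /corner.
by case: (U _) => a b /= ->.
Qed.

Lemma corner_kernel :
  [/\ subspace [set x : H1 | corner x = 0], sclosed [set x : H1 | corner x = 0] &
      forall A x, measurable A -> corner x = 0 -> corner (E A x) = 0].
Proof.
have c0 : corner (0 : H1) = 0 by rewrite -(subrr 0) corner_sub subrr.
split.
- split=> // a x y /= x0 y0; rewrite corner_linear x0 y0.
  by rewrite scaler0 addr0.
- move=> u x ux0 ux /=; apply: (sconv_unique (u := corner \o u)).
    apply: (@sconv_contr _ _ _ (corner) 1) ux => v w.
    by rewrite mul1r -corner_sub corner_contr.
  by rewrite (_ : _ \o _ = fun=> 0); [exact: sconv_cst|apply/funext => n /=; exact: ux0].
- move=> A x mA x0.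
  by rewrite corner_E // x0 pvm_zero.
Qed.

Lemma inverse_intertwines : (forall y, dom T' y <-> dom T (W y)) /\
  (forall y, dom T' y -> app T (W y) = W (app T' y)).
Proof.
have dW y : dom T' y <-> dom T (W y) by rewrite domU WU.
split=> // y Dy; apply: (unitary_inj uU).
by rewrite WU -appU ?WU // -dW.
Qed.

End Direction.

(** * The kernels of the entry and of its adjoint *)

Section Kernels.
Variables (R : realType) (H1 H2 H1' H2' : hilbertType R).
Variables (N1 : operator H1 H1) (N2 : operator H2 H2).
Variables (C1 : H1 -> H2) (C2 : H2 -> H1).
Variables (N1' : operator H1' H1') (N2' : operator H2' H2').
Variables (C1' : H1' -> H2') (C2' : H2' -> H1').
Hypotheses (hT : model_data N1 N2 C1 C2) (hT' : model_data N1' N2' C1' C2').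
Variables (E : spectral_measure H1) (E' : spectral_measure H1').
Hypotheses (N_E : spectral_measure_of N1 E) (N_E' : spectral_measure_of N1' E').
Hypotheses (E_K : E (~` K (R := R)) = (fun=> 0)).
Hypotheses (E_K' : E' (~` K (R := R)) = (fun=> 0)).

Local Notation H := (hsum H1 H2).
Local Notation H' := (hsum H1' H2').
Local Notation T := (model_T N1 N2 C1 C2).
Local Notation T' := (model_T N1' N2' C1' C2').

Variables (U : H -> H') (W : H' -> H).
Hypotheses (uU : unitary U) (uW : unitary W) (UW : cancel U W) (WU : cancel W U).
Hypothesis domU : forall x, dom T x <-> dom T' (U x).
Hypothesis appU : forall x, dom T x -> app T' (U x) = U (app T x).
Let domW := (inverse_intertwines uU WU domU appU).1.
Let appW := (inverse_intertwines uU WU domU appU).2.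

Lemma pvm_ball_dom (V : hilbertType R) (N : operator V V) (G : spectral_measure V) n x :
  spectral_measure_of N G -> dom N (G (cball 0 n%:R) x).
Proof.
move=> NG; have mB : measurable (cball 0 n%:R : set (borelC R)).
  exact: measurable_cball.
apply: (pvm_bounded_dom NG mB (L := n%:R)); first by rewrite pvm_idempotent.
by move=> z; rewrite /cball /= subr0.
Qed.

(** For z in the kernel and z' = [twisted] z, T' sends U (z, 0) = (0, C1' z') to (N1' z', 0), which
    is also U T (z, 0), the image of a vector of H2. So N1' z' is in the kernel of [corner W], and
    [invariant_mem] cancels N1'. *)
Lemma twisted_kernel x : corner U x = 0 -> corner W (twisted C2' U x) = 0.
Proof.
move=> x0.
have [C10 _ _ _] := antilinear_rules (model_C1_antilinear hT).
have [C20 _ _ _] := antilinear_rules (model_C2_antilinear hT).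
have [C10' _ _ _] := antilinear_rules (model_C1_antilinear hT').
have [l1 l2] := model_N_linear hT; have [l1' l2'] := model_N_linear hT'.
have [_ _ kE] := corner_kernel hT hT' N_E N_E' E_K E_K' uU uW UW WU domU appU.
have [sub cl inv] :=
  corner_kernel hT' hT N_E' N_E E_K' E_K uW uU WU UW domW appW.
apply: (invariant_mem l1' (model_N1_dense hT') N_E' E_K' sub cl) => [B y mB|n] /=.
  exact: inv.
have mB : measurable (cball 0 n%:R : set (borelC R)) by exact: measurable_cball.
rewrite -(twisted_E hT hT' N_E N_E' E_K E_K' uU uW UW WU domU appU) //.
set z := E _ x; have z0 : corner U z = 0 by exact: kE.
have Dz : dom N1 z by exact: pvm_ball_dom.
have DT : dom T ((z, 0) : H).
  by apply/model_T_dom => //=; split=> //; rewrite C20; exact: dom0.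
have := appU DT; rewrite (U_twisted hT' z0) !model_T_app /= C10' C20.
rewrite (model_CK hT').1 (app0 l1) (app0 l2') /corner => ->.
by rewrite UW.
Qed.

(** The image of the kernel is a closed subspace that E' leaves invariant; over each disc it
    contains N1' y', and [invariant_mem] cancels N1'. *)
Lemma twisted_onto y : corner W y = 0 ->
  exists2 x, corner U x = 0 & twisted C2' U x = y.
Proof.
move=> y0.
have [C10 _ _ _] := antilinear_rules (model_C1_antilinear hT).
have [C20 _ _ _] := antilinear_rules (model_C2_antilinear hT).
have [C20' _ _ _] := antilinear_rules (model_C2_antilinear hT').
have [l1 l2] := model_N_linear hT; have [l1' l2'] := model_N_linear hT'.
have [ksub kcl kE] := corner_kernel hT hT' N_E N_E' E_K E_K' uU uW UW WU domU appU.
have [_ _ kE'] := corner_kernel hT' hT N_E' N_E E_K' E_K uW uU WU UW domW appW.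
have twE := twisted_E hT hT' N_E N_E' E_K E_K' uU uW UW WU domU appU.
have tal := twisted_antilinear hT' uU (C2' := C2').
have [tw0 twD twB twZ] := antilinear_rules tal.
pose M := [set y | exists2 x, corner U x = 0 & twisted C2' U x = y].
apply: (@invariant_mem _ _ N1' E' l1' (model_N1_dense hT') N_E' E_K' M).
- split=> [|a v w [x x0 <-] [x' x0' <-]].
    by exists 0; [case: ksub|].
  exists (a^* *: x + x'); first by case: ksub => _; apply.
  by rewrite twD twZ conjCK.
- move=> u v uM uv.
  have /choice[x xP] n : exists x, corner U x = 0 /\ twisted C2' U x = u n.
    by have [x ? ?] := uM n; exists x.
  (* [twisted] is isometric on the kernel, so the preimages form a Cauchy sequence. *)
  have [|x0 xx] := @scauchy_sconv _ _ x.
    move=> e e0; have [m mP] := sconv_scauchy uv e0; exists m => p q mp mq.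
    rewrite -(twisted_hn hT' uU); last first.
      by rewrite corner_sub // (xP p).1 (xP q).1 subrr.
    by rewrite twB (xP p).2 (xP q).2 mP.
  exists x0; first by apply: kcl xx => n; case: (xP n).
  apply: sconv_unique uv; rewrite (_ : u = twisted C2' U \o x); last first.
    by apply/funext => n /=; rewrite (xP n).2.
  apply: (@sconv_contr _ _ _ _ 1) xx => p q.
  by rewrite mul1r -twB (twisted_contr hT').
- move=> B v mB [x x0 <-]; exists (E B x); first exact: kE.
  exact: twE.
move=> n; have mB : measurable (cball 0 n%:R : set (borelC R)).
  exact: measurable_cball.
set y' := E' _ y; have y'0 : corner W y' = 0 by exact: kE'.
have Dy' : dom N1' y' by exact: pvm_ball_dom.
(* T sends W (y', 0) = (0, C1 z) to (N1 z, 0), hence U (N1 z, 0) = (0, C1' (N1' y')): the preimage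
   of N1' y' is N1 z. *)
pose z := twisted C2 W y'.
have DT : dom T' ((y', 0) : H').
  by apply/model_T_dom => //=; split=> //; rewrite C20'; exact: dom0.
have := appW DT; rewrite (U_twisted hT y'0) !model_T_app /= C10.
rewrite (model_app_C1 hT') // C20' (app0 l1') (app0 l2) (model_CK hT).1.
move/(congr1 U); rewrite WU -/z => Uz.
by exists (app N1 z); rewrite /corner /twisted Uz //= (model_CK hT').1.
Qed.

(* The pairs (|G| x, G x) give the polar decomposition of G = corner U. On the
   kernel of G, [twisted] is antiunitary onto the kernel of the adjoint of G, and
   it is linear over R on a real form of the kernel. *)
Lemma model_forward : exists2 u : H1 -> H1', unitary u &
  (forall B x, measurable B -> u (E B x) = E' B (u x)).
Proof.
have cE := corner_E hT hT' N_E N_E' E_K E_K' uU uW UW WU domU appU.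
have [ksub kcl kE] := corner_kernel hT hT' N_E N_E' E_K E_K' uU uW UW WU domU appU.
have twE := twisted_E hT hT' N_E N_E' E_K E_K' uU uW UW WU domU appU.
have tal := twisted_antilinear hT' uU (C2' := C2').
have [tw0 twD twB twZ] := antilinear_rules tal.
have adj := corner_adjoint uU WU.
have adjW x y : hdot (corner W y) x = hdot y (corner U x).
  by rewrite hdotC [RHS]hdotC adj.
have clin := corner_linear uU; have clinW := corner_linear uW.
pose G := corner U; pose G' := corner W.
have GE B y : measurable B -> G' (E' B y) = E B (G' y).
  move=> mB; apply: hdot_ext => x.
  by rewrite adjW (pvm_selfadjoint _ mB) -cE // -adjW (pvm_selfadjoint _ mB).
(* With X = 1 - G* G, the operator S obtained from [sqrt_exists] is |G|. *)
pose X x := x - G' (G x).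
have X_lin : linear X.
  move=> a x y; rewrite /X /G clin /G' clinW scalerBr opprD addrACA //.
have X_sa x y : hdot (X x) y = hdot x (X y).
  by rewrite /X hdotBl hdotBr adjW adj.
have X_contr x : hn (X x) <= hn x.
  apply: hn_le_sq; first exact: hn_ge0.
  have g1 := corner_contr uU x; have g2 := corner_contr uW (G x).
  (* |x - G* G x|^2 = |x|^2 - 2 |G x|^2 + |G* G x|^2, and G* is a contraction. *)
  have := hn_sqD x (- G' (G x)); rewrite -/(X x) hnN hdotNr -adj -/G => ->.
  rewrite hn2E /= -/(G' (G x)).
  have h0 := hn_ge0 (G' (G x)); have h1 := hn_ge0 (G x).
  have : hn (G' (G x)) ^+ 2 <= hn (G x) ^+ 2.
    by rewrite ler_pXn2r ?nnegrE.
  have := sqr_ge0 (hn (G x)); lra.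
have [S [S_sa S2 S_comm]] := sqrt_exists X_lin X_sa X_contr.
have SS x : S (S x) = G' (G x) by rewrite S2 /X subKr.
have S_dot x y : hdot (S x) (S y) = hdot (G x) (G y).
  by rewrite S_sa SS -adj.
have SE B x : measurable B -> E B (S x) = S (E B x).
  move=> mB; apply: S_comm => [a y z|y|y]; first exact: pvm_linear.
    exact: pvm_contr.
  by rewrite /X pvm_sub // -GE // -cE.
have S_ker x : G x = 0 -> S x = 0.
  by move=> x0; apply: hdotxx_eq0; rewrite S_dot x0 hdot0l.
have S_ker' x : S x = 0 -> G x = 0.
  by move=> x0; apply: hdotxx_eq0; rewrite -S_dot x0 hdot0l.
have tw_dot x y : G x = 0 -> G y = 0 ->
    hdot (twisted C2' U x) (twisted C2' U y) = (hdot x y)^*.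
  move=> x0 y0; have [_ dU _] := uU; rewrite /twisted (model_C2_dot hT').
  congr (_^*); have := dU ((x, 0) : H) ((y, 0) : H); rewrite !hsum_hdotE /=.
  by rewrite -/(corner U x) -/G x0 hdot0l hdot0l add0r addr0.
have [Z [Zk Zreal Ztot]] := real_form (E := E) (k := [set x | G x = 0]) kE.
pose P0 : set (H1 * H1') := [set p | (exists x, p = (S x, G x)) \/
  (exists2 s, Z s & p = (s, twisted C2' U s))].
(* The two kinds of pairs are orthogonal on both sides: the range of S to the kernel of G, and the
   range of G to the kernel of its adjoint. *)
have cross B x s : measurable B -> Z s ->
    hdot (E B (S x)) s = 0 /\ hdot (E' B (G x)) (twisted C2' U s) = 0.
  move=> mB Zs; have s0 : G s = 0 := Zk s Zs; split.
    by rewrite SE // S_sa S_ker // hdot0r.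
  by rewrite -cE // adj -/(corner W _) twisted_kernel // hdot0r.
have [||y yP|u [uu uE _]] := @unitary_of_pairs _ _ _ E E' P0.
- move=> p q B [[x ->]|[s Zs ->]] [[y ->]|[t Zt ->]] mB /=.
  + by rewrite SE // S_dot /G cE.
  + by have [-> ->] := cross B x t mB Zt.
  + have [c1 c2] := cross B y s mB Zs.
    by rewrite !(pvm_selfadjoint _ mB) hdotC [RHS]hdotC c1 c2.
  + have s0 : G s = 0 := Zk s Zs; have t0 : G t = 0 := Zk t Zt.
    (* [twisted] conjugates the form, which is real on Z. *)
    rewrite -twE // tw_dot //; last exact: kE.
    by rewrite Zreal.
(* Orthogonality to the range of S puts x in the kernel of G, where Z is total. *)
- move=> x xP; apply: Ztot => [|s Zs]; last by apply: (xP (s, _)); right; exists s.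
  apply: S_ker'; apply: hdot_ext => y; rewrite hdot0l S_sa.
  by apply: (xP (S y, G y)); left; exists y.
(* Orthogonality to the range of G puts y in the kernel of the adjoint, so y is the image of some x
   in the kernel of G, and totality of Z applies to x. *)
- have y0 : corner W y = 0.
    apply: hdot_ext => x; rewrite hdot0l adjW.
    by apply: (yP (S x, G x)); left; exists x.
  have [x x0 xy] := twisted_onto y0; rewrite -xy (_ : x = 0) //.
  apply: Ztot => // s Zs; have s0 : G s = 0 := Zk s Zs.
  have : hdot y (twisted C2' U s) = 0 by apply: (yP (s, _)); right; exists s.
  by rewrite -xy tw_dot // => /(congr1 Num.conj); rewrite conjCK conjC0.
- by exists u.
Qed.

End Kernels.

Theorem proposition18 (R : realType) (H1 H2 H1' H2' : hilbertType R)
    (N1 : operator H1 H1) (N2 : operator H2 H2)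
    (C1 : H1 -> H2) (C2 : H2 -> H1)
    (N1' : operator H1' H1') (N2' : operator H2' H2')
    (C1' : H1' -> H2') (C2' : H2' -> H1')
    (hT : model_data N1 N2 C1 C2) (hT' : model_data N1' N2' C1' C2')
    (hK : K_supported N1) (hK' : K_supported N1') :
  unitarily_equivalent (model_T N1 N2 C1 C2) (model_T N1' N2' C1' C2') <->
  exists (u1 : H1 -> H1') (u2 : H2 -> H2'),
    [/\ unitary u1, unitary u2,
        (unitary_conj u1 N1 =op N1'), (unitary_conj u2 N2 =op N2') &
        (forall x, u2 x = C1' (u1 (C2 x)))].
Proof.
have [C1K C2K] := model_CK hT; have [C1K' C2K'] := model_CK hT'.
split=> [[U uU /(unitary_conjP uU)[domU appU]]|].
  have [E N_E E_K] := hK; have [E' N_E' E_K'] := hK'.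
  have [W [uW UW WU]] := unitary_inverse uU.
  have [u1 uu1 u1E] := model_forward hT hT' N_E N_E' E_K E_K' uU uW UW WU domU appU.
  have [dom1 app1] := operator_transport (model_N_linear hT).1
    (model_N_linear hT').1 (model_N1_dense hT) N_E N_E' uu1 u1E.
  pose u2 x := C1' (u1 (C2 x)).
  have uu2 : unitary u2.
    case: uu1 => lu du ru; split.
    - move=> a x y; have := model_C2_antilinear hT a 1 x y; rewrite scale1r => C2E.
      rewrite /u2 C2E lu conjC1 scale1r -[u1 (C2 y)]scale1r.
      by rewrite (model_C1_antilinear hT') conjCK conjC1 !scale1r.
    - move=> x y; rewrite /u2 (model_C1_dot hT') du (model_C2_dot hT).
      exact: conjCK.
    - apply/seteqP; split=> // y _; have [x _ ux] : range u1 (C2' y) by rewrite ru.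
      by exists (C1 x) => //; rewrite /u2 C1K ux C2K'.
  exists u1, u2; split=> //; first exact/(unitary_conjP uu1).
  apply/(unitary_conjP uu2); split=> x.
    by rewrite -(model_dom_C2 hT) dom1 -(model_dom_C1 hT').
  move=> Dx; have D1 : dom N1 (C2 x) by apply/(model_dom_C2 hT).
  rewrite /u2 (model_app_C1 hT'); last exact/dom1.
  by rewrite app1 // (model_app_C2 hT).
move=> [u1 [u2 [uu1 uu2 /(unitary_conjP uu1)[dom1 app1]]]].
move=> /(unitary_conjP uu2)[dom2 app2] u2E.
(* The relation between u1 and u2 says that their direct sum commutes with the conjugations; this
   sum is the required U. *)
have u1C2 y : C2' (u2 y) = u1 (C2 y) by rewrite u2E C1K'.
have u2C1 x : u2 (C1 x) = C1' (u1 x) by rewrite u2E C1K.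
pose U (x : hsum H1 H2) : hsum H1' H2' := (u1 x.1, u2 x.2).
have uU : unitary U.
  case: uu1 uu2 => [l1 d1 r1] [l2 d2 r2]; split.
  - by move=> a x y; rewrite /U /= l1 l2.
  - by move=> x y; rewrite !hsum_hdotE /= d1 d2.
  - apply/seteqP; split=> // -[a b] _.
    have [x _ xa] : range u1 a by rewrite r1.
    have [y _ yb] : range u2 b by rewrite r2.
    by exists (x, y) => //; rewrite /U /= xa yb.
exists U => //; apply/(unitary_conjP uU); split=> x.
  by rewrite (model_T_dom hT) (model_T_dom hT') /= u1C2 -!dom1.
move=> /(model_T_dom hT)[D1 D2].
rewrite (model_T_appE hT) // (model_T_appE hT'); last exact/dom1.
by rewrite /U /= u1C2 !app1 // u2C1.
Qed.
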